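(* Let $n\ge1$ and let $f,g\in L^2(\mathbb{H}^n)$ be nonzero functions. Suppose that $\Omega\subseteq\mathbb{H}^n\times\mathbb{H}^n$ is measurable and that $0<\epsilon_\Omega<1$. If $V_gf$ is $\epsilon_\Omega$-concentrated on $\Omega$, then for every $p>2$, $$|\Omega|\ge(1-\epsilon_\Omega^2)^{\frac{p}{p-2}}.$$
   Context: $\mathbb{H}^n=\mathbb{R}^n\times\mathbb{R}^n\times\mathbb{R}\cong\mathbb{R}^{2n+1}$ is the Heisenberg group with group law $(p,q,t)\cdot(p',q',t')=\left(p+p',q+q',t+t'+\tfrac12(pq'-qp')\right)$, where $pq$ is the Euclidean dot product on $\mathbb{R}^n$. Its Haar measure is Lebesgue measure on $\mathbb{R}^{2n+1}$, so $L^2(\mathbb{H}^n)=L^2(\mathbb{R}^{2n+1})$. $\mathcal{F}$ is the Euclidean Fourier transform on $\mathbb{R}^{2n+1}$, $\mathcal{F}(h)(Q)=\int_{\mathbb{R}^{2n+1}}h(X)e^{-2\pi i\langle Q,X\rangle}\,dX$, extended to a unitary operator on $L^2(\mathbb{R}^{2n+1})$; here $\langle Q,X\rangle$ is the Euclidean inner product on $\mathbb{R}^{2n+1}$. The short-time Fourier transform of $f\in L^2(\mathbb{H}^n)$ with window $g\in L^2(\mathbb{H}^n)$ is $$V_gf(Q,P)=\int_{\mathbb{R}^{2n+1}}\mathcal{F}(f)(X)\,\overline{\mathcal{F}(g)(X\cdot P)}\,e^{-2\pi i\langle Q,X\rangle}\,dX,\qquad Q,P\in\mathbb{H}^n,$$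 with $X\cdot P$ the Heisenberg product. $|\Omega|$ is the Lebesgue measure of $\Omega$. For $0<\epsilon_\Omega<1$, $V_gf$ is called $\epsilon_\Omega$-concentrated on $\Omega$ if $\|\chi_{\Omega^c}V_gf\|_2\le\epsilon_\Omega\|V_gf\|_2$, with $L^2(\mathbb{H}^n\times\mathbb{H}^n)$ norms and $\chi_{\Omega^c}$ the indicator function of the complement of $\Omega$. *)

(* Defs.v *)
From HB Require Import structures.
From mathcomp Require Import all_boot all_order all_algebra.
From mathcomp Require Import all_classical all_reals all_analysis.
From mathcomp Require Import complex.

Set Implicit Arguments.
Unset Strict Implicit.
Unset Printing Implicit Defensive.

Import Order.TTheory GRing.Theory Num.Theory.
Import numFieldNormedType.Exports.

Local Open Scope classical_set_scope.
Local Open Scope ring_scope.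

Definition tcons (T : Type) (n : nat) (x : T * n.-tuple T) : n.+1.-tuple T :=
  [tuple of x.1 :: x.2].

Lemma measurable_tcons d (T : measurableType d) n :
  measurable_fun setT (@tcons T n).
Proof. exact: measurable_cons. Qed.

Section SigmaFiniteProduct.
Context d1 d2 (T1 : measurableType d1) (T2 : measurableType d2) (R : realType).
Variables (m1 : {sigma_finite_measure set T1 -> \bar R})
          (m2 : {sigma_finite_measure set T2 -> \bar R}).

Lemma sigma_finite_product : sigma_finite setT (m1 \x m2)%E.
Proof.
have /sigma_finiteP[F [TF ndF Foo]] := sigma_finiteT m1.
have /sigma_finiteP[G [TG ndG Goo]] := sigma_finiteT m2.
exists (fun n => F n `*` G n).
  rewrite -setXTT TF TG predeqE => -[x y]; split.
    move=> [/= [n _ Fnx] [k _ Gky]]; exists (maxn n k) => //; split.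
    - by move: x Fnx; exact/subsetPset/ndF/leq_maxl.
    - by move: y Gky; exact/subsetPset/ndG/leq_maxr.
  by move=> [n _ []/= ? ?]; split; exists n.
move=> k; have [? ?] := Foo k; have [? ?] := Goo k.
split; first exact: measurableX.
by rewrite product_measure1E// lte_mul_pinfty// ge0_fin_numE.
Qed.

(* The measure m1 \x m2 with its sigma-finite structure, which is not inferred
   for two sigma-finite factors. *)
Definition sf_prod : {sigma_finite_measure set (T1 * T2)%type -> \bar R} :=
  HB.pack_for {sigma_finite_measure set (T1 * T2)%type -> \bar R}
    (m1 \x m2)%E
    (Measure_isSigmaFinite.Build _ _ _ (m1 \x m2)%E sigma_finite_product).

End SigmaFiniteProduct.

Section TupleCons.
Context d (T : measurableType d) (R : realType) (n : nat).
Variables (m : {sigma_finite_measure set T -> \bar R})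
          (mu : {sigma_finite_measure set (n.-tuple T) -> \bar R}).

Definition tcons_measure : set (n.+1.-tuple T) -> \bar R :=
  pushforward (m \x mu)%E (@tcons T n).

Let P : {measure set (n.+1.-tuple T) -> \bar R} :=
  measure_function_pushforward__canonical__measure_function_Measure
    (m \x mu)%E (@measurable_tcons _ T n).

Let tcons_measure0 : tcons_measure set0 = 0%E.
Proof. exact: (measure0 P). Qed.

Let tcons_measure_ge0 A : (0 <= tcons_measure A)%E.
Proof. exact: (measure_ge0 P). Qed.

Let tcons_measure_sigma_additive :
  measure_function.semi_sigma_additive tcons_measure.
Proof. exact: (@measure_semi_sigma_additive _ _ _ P). Qed.

HB.instance Definition _ := isMeasure.Build _ _ _ tcons_measure
  tcons_measure0 tcons_measure_ge0 tcons_measure_sigma_additive.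

Let tcons_measure_sigma_finite : sigma_finite setT tcons_measure.
Proof.
have [F FT Foo] := sigma_finite_product m mu.
pose u (t : n.+1.-tuple T) : T * n.-tuple T := (thead t, [tuple of behead t]).
have mu_ : measurable_fun setT u.
  apply/measurable_fun_pairP; split.
    exact: (@measurable_tnth _ T n.+1 ord0).
  exact: measurable_behead.
have uK x : u (tcons x) = x.
  by case: x => a b; rewrite /u /tcons theadE; congr pair; exact: val_inj.
exists (fun k => u @^-1` F k).
  by rewrite -preimage_bigcup -FT preimage_setT.
move=> k; have [mF Fk] := Foo k; split.
  by rewrite -[X in measurable X]setTI; exact: mu_.
rewrite /tcons_measure /pushforward -comp_preimage.
rewrite (_ : u \o @tcons T n = id) ?preimage_id//.
by apply/funext => x; exact: uK.
Qed.

HB.instance Definition _ := Measure_isSigmaFinite.Build _ _ _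
  tcons_measure tcons_measure_sigma_finite.

End TupleCons.

(* Lebesgue measure on R^n (Borel sets), as the iterated product measure
   transported to n.-tuple R. *)
Fixpoint leb (R : realType) (n : nat) :
    {sigma_finite_measure set (n.-tuple (measurableTypeR R)) -> \bar R} :=
  match n with
  | 0 => \d_([tuple] : 0.-tuple (measurableTypeR R))
  | k.+1 => tcons_measure lebesgue_measure (leb R k)
  end.

Local Open Scope complex_scope.

(* Elements of L^p are represented by functions. On the Borel measures below
   this loses nothing: every class of L^p has a Borel representative. *)
Section ComplexFunctions.
Context d (T : measurableType d) (R : realType).
Variable mu : {measure set T -> \bar R}.
Implicit Types f : T -> R[i].

Definition cmeasurable_fun f : Prop :=
  measurable_fun setT (fun x => complex.Re (f x)) /\
  measurable_fun setT (fun x => complex.Im (f x)).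

(* Meaningful when Re f and Im f are integrable. *)
Definition cintegral f : R[i] :=
  (\int[mu]_x complex.Re (f x)) +i* (\int[mu]_x complex.Im (f x)).

Definition cLnorm (p : \bar R) f : \bar R :=
  Lnorm mu p (fun x => (Normc.normc (f x))%:E).

Definition in_Lp (p : \bar R) f : Prop :=
  cmeasurable_fun f /\ (cLnorm p f < +oo)%E.

End ComplexFunctions.

Definition cexpi (R : realType) (a : R) : R[i] := cos a +i* sin a.

Notation heis R n :=
  (n.-tuple (measurableTypeR R) * n.-tuple (measurableTypeR R)
   * measurableTypeR R)%type.

Section Heisenberg.
Context (R : realType) (n : nat).
Implicit Types (p q : n.-tuple (measurableTypeR R)) (X Y P Q : heis R n).

Definition dotp p q : R := \sum_(i < n) (tnth p i : R) * (tnth q i : R).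

Definition addp p q : n.-tuple (measurableTypeR R) :=
  [tuple (tnth p i : R) + (tnth q i : R) | i < n].

Definition heis_mul X Y : heis R n :=
  (addp X.1.1 Y.1.1, addp X.1.2 Y.1.2,
   (X.2 : R) + (Y.2 : R) + 2^-1 * (dotp X.1.1 Y.1.2 - dotp X.1.2 Y.1.1)).

Definition heis_dot X Y : R :=
  dotp X.1.1 Y.1.1 + dotp X.1.2 Y.1.2 + (X.2 : R) * (Y.2 : R).

Definition leb_heis : {sigma_finite_measure set (heis R n) -> \bar R} :=
  sf_prod (sf_prod (leb R n) (leb R n)) lebesgue_measure.

(* The defining integral, absolutely convergent for h in L^1. *)
Definition fourier1 (h : heis R n -> R[i]) Q : R[i] :=
  cintegral leb_heis (fun X => h X * cexpi (- (2 * pi * heis_dot Q X))).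

(* The extension of fourier1 from L^1 `&` L^2 to L^2 by continuity: H is the
   L^2 limit of the transforms of some L^2 approximation of h by functions of
   L^1 `&` L^2. By Plancherel such an H exists and is unique up to a.e.
   equality; fourier2 picks one. *)
Definition is_fourier2 (h H : heis R n -> R[i]) : Prop :=
  in_Lp leb_heis 2 H /\
  exists u : nat -> heis R n -> R[i],
    [/\ forall k, in_Lp leb_heis 1 (u k) /\ in_Lp leb_heis 2 (u k),
        cLnorm leb_heis 2 (fun X => u k X - h X) @[k --> \oo] --> 0%E &
        cLnorm leb_heis 2 (fun X => fourier1 (u k) X - H X) @[k --> \oo]
          --> 0%E].

Definition fourier2 (h : heis R n -> R[i]) : heis R n -> R[i] :=
  xget (fun=> 0) [set H | is_fourier2 h H].

(* The value at each point depends only on the a.e. classes of the two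
   transforms, because right translations preserve null sets. *)
Definition stft (g f : heis R n -> R[i]) (QP : heis R n * heis R n) : R[i] :=
  cintegral leb_heis (fun X =>
    fourier2 f X * conjc (fourier2 g (heis_mul X QP.2))
    * cexpi (- (2 * pi * heis_dot QP.1 X))).

Definition leb_heis2_borel :
    {sigma_finite_measure set (heis R n * heis R n)%type -> \bar R} :=
  sf_prod leb_heis leb_heis.

(* heis2 carries the sigma-algebra of all Lebesgue measurable subsets of
   H^n * H^n, and leb_heis2 is the complete Lebesgue measure on it. *)
Definition heis2 := caratheodory_type (leb_heis2_borel^*)%mu.
Definition leb_heis2 : {measure set heis2 -> \bar R} :=
  @completed_measure_extension _ _ _ leb_heis2_borel.

Definition concentrated (eps : R) (Omega : set heis2) (F : heis2 -> R[i]) :=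
  (cLnorm leb_heis2 2 (fun z => (\1_(~` Omega) z)%:C * F z)%R
   <= eps%:E * cLnorm leb_heis2 2 F)%E.

End Heisenberg.

(* Main.v *)
(** The exponent is at least 1, so it suffices to prove |Omega| >= 1 - eps^2.
    Write F, G for the transforms of f, g, and A = ||F||^2 ||G||^2. For fixed P,
    Q |-> V(Q, P) is the Fourier transform of X |-> F(X) conj(G(X.P)).
    By Cauchy-Schwarz and right invariance of the measure, |V|^2 <= A everywhere;
    by Plancherel, Tonelli and left invariance, ||V||^2 = A. Concentration then
    gives A <= A |Omega| + eps^2 A, and 0 < A < oo since f and g are nonzero.

    For a real integrable a on the line, Plancherel comes from comparing the
    kernel k(y, x) = sin(pi h y) / (pi y) * exp(2 i pi x y) with the box
    k'(z, x) = 1 if x - h <= z < x, 0 otherwise: both have the Gram function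
    (|t + h| + |t - h| - 2|t|) / 2 at t = x - x'. Hence
      int (sin(pi h y) / (pi y))^2 |a^(y)|^2 dy = int (int_z^(z+h) a)^2 dz,
    and dividing by h^2 and letting h tend to 0 gives the theorem, by Fatou in
    both directions and Lebesgue differentiation. *)

Require Import Defs.
From mathcomp Require Import all_boot all_order all_algebra.
From mathcomp Require Import all_classical all_reals all_analysis.
From mathcomp Require Import complex.
From mathcomp Require Import measurable_realfun ring lra.
Import Order.TTheory GRing.Theory Num.Theory.
Import numFieldNormedType.Exports.
Local Open Scope classical_set_scope.
Local Open Scope ring_scope.

Set Implicit Arguments.
Unset Strict Implicit.
Unset Printing Implicit Defensive.

(** * The integral of (1 - cos (t x)) / x^2 *)

Section CosineIntegral.
Context (R : realType).
Local Notation mu := (@lebesgue_measure R).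
Implicit Types (s t x h : R).

(** For fixed P the function X |-> F(X) conj(G(X.P)) is a product of two L^2 functions, hence only
    known to be integrable, and its square integral may be infinite for exceptional P. This is why
    [plancherel] is stated as an identity in [0, +oo] for every L^1 function and proved by comparing
    nonnegative integrals. The comparison rests on the fact that int (int a(x) k(z, x) dx)^2 dz
    depends on k only through its Gram function int k(z, x) k(z, x') dz. For the sinc kernel that
    function is computed from int (1 - cos(t x)) / x^2 dx = pi |t|, for the box from the overlap of
    two intervals; squaring the sinc kernel yields a second difference of 1 - cos, whence the second
    difference of |t|. The factor A cancels at the end, so what must be known of the transforms that
    [fourier2] picks is that their norms are finite and nonzero; both are read off the approximating
    sequences. Finally, V is Borel while Omega is only Lebesgue measurable, so the concentration
    estimate is carried out on the completed measure. *)

Lemma ge0_FTC2y (f F : R -> R) (a l : R) :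
  (forall x, a <= x -> 0 <= f x) -> continuous f ->
  (forall x, is_derive x 1 F (f x)) -> F x @[x --> +oo] --> l ->
  (\int[mu]_(x in `[a, +oo[) (f x)%:E = (l - F a)%:E)%E.
Proof.
move=> f0 cf dF Fl; rewrite (@ge0_continuous_FTC2y _ f F a l)//.
- exact: continuous_subspaceT.
- apply: cvg_at_right_filter; apply: differentiable_continuous.
  by apply/derivable1_diffP.
- by move=> x _; rewrite derive1E; exact: derive_val.
Qed.

Lemma expRN_cvg0 s : 0 < s -> expR (- (s * x)) @[x --> +oo] --> (0 : R).
Proof.
move=> s0; apply: (@cvg_comp _ _ _ (fun x => s * x) (fun y => expR (- y)) _ +oo).
  exact: gt0_cvgMry.
exact: cvgr_expR.
Qed.

(** The bound [exp u >= 1 + u^2 / 2] at u = s x puts the expression below 2 / (x^2 s). *)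
Lemma mul_expRN_cvg0 x : 0 < x -> s * expR (- (s * x)) @[s --> +oo] --> (0 : R).
Proof.
move=> x0.
apply: (@squeeze_cvgr _ _ _ _ (cst 0) (fun s => 2 / x ^+ 2 * s^-1)).
- near=> s.
  have s0 : 0 < s by near: s; exact: nbhs_pinfty_gt.
  rewrite mulr_ge0 ?expR_ge0 ?(ltW s0)//=.
  rewrite expRN ler_pdivrMr ?expR_gt0//.
  have sx0 : 0 <= s * x by rewrite mulr_ge0 ?ltW.
  apply: (@le_trans _ _ (2 / x ^+ 2 / s * ((s * x) ^+ 2 / 2))).
    rewrite le_eqVlt; apply/orP; left; apply/eqP; field.
    by rewrite !gt_eqF.
  apply: ler_wpM2l.
    by rewrite !mulr_ge0 ?invr_ge0 ?(ltW s0) ?exprn_ge0 ?(ltW x0).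
  by apply: le_trans (expR_ge1Dxn 1 sx0); rewrite ler_wpDl.
- exact: cvg_cst.
- rewrite -[X in _ --> X](mulr0 (2 / x ^+ 2)); apply: cvgMl_tmp.
  apply/gtr0_cvgV0; last exact: cvg_id.
  by near=> y; near: y; exact: nbhs_pinfty_gt.
Unshelve. all: by end_near. Qed.

Lemma integral_mul_expRN x : 0 < x ->
  (\int[mu]_(s in `[0%R, +oo[) (s * expR (- (s * x)))%:E = (x ^- 2)%:E)%E.
Proof.
move=> x0.
pose F s := - ((s / x + x ^- 2) * expR (- (s * x))).
have dF s : is_derive s 1 F (s * expR (- (s * x))).
  apply: is_derive_eq; rewrite /GRing.scale/=.
  by field; rewrite gt_eqF.
rewrite (@ge0_FTC2y _ F 0 0 _ _ dF) /F.
- by rewrite !(mul0r, oppr0, add0r, expR0, mulr1, opprK).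
- by move=> s s0; rewrite mulr_ge0 ?expR_ge0.
- move=> s; apply: cvgM => //.
  apply: (@continuous_comp _ _ _ (fun s => - (s * x)) expR).
    by apply: cvgN; apply: cvgM => //; exact: cvg_cst.
  exact: continuous_expR.
- have h1 := mul_expRN_cvg0 x0.
  have h2 : expR (- (s * x)) @[s --> +oo] --> (0 : R).
    by under eq_fun do rewrite mulrC; exact: expRN_cvg0.
  have -> : (fun s => - ((s / x + x ^- 2) * expR (- (s * x)))) =
      (fun s => - (s * expR (- (s * x)) * x^-1 + x ^- 2 * expR (- (s * x)))).
    by apply/funext => s; ring.
  have -> : 0 = - (0 * x^-1 + x ^- 2 * 0) :> R by rewrite mul0r mulr0 addr0 oppr0.
  by apply: cvgN; apply: cvgD; [exact: cvgMr_tmp|exact: cvgMl_tmp].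
Qed.

Lemma integral_onemcos_expRN t s : 0 < s ->
  (\int[mu]_(x in `[0%R, +oo[) ((1 - cos (t * x)) * expR (- (s * x)))%:E =
   (t ^+ 2 / (s * (s ^+ 2 + t ^+ 2)))%:E)%E.
Proof.
move=> s0.
have st : s ^+ 2 + t ^+ 2 != 0 by rewrite gt_eqF// ltr_pwDl ?exprn_gt0 ?sqr_ge0.
(* The primitive exp(-s x) A(x) comes from integrating by parts twice. [A] is bounded, so the limit
   at +oo is 0 and the integral is -A(0). *)
pose A x := (s * cos (t * x) - t * sin (t * x)) / (s ^+ 2 + t ^+ 2) - s^-1.
pose F x := expR (- (s * x)) * A x.
have dF x : is_derive x 1 F ((1 - cos (t * x)) * expR (- (s * x))).
  apply: is_derive_eq; rewrite /GRing.scale/=.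
  by rewrite /A; field; rewrite st gt_eqF.
rewrite (@ge0_FTC2y _ F 0 0 _ _ dF) /F.
- rewrite /A !(mulr0, oppr0, add0r, expR0, mulr1, cos0, sin0, mul1r, subr0).
  by congr EFin; field; rewrite st gt_eqF.
- by move=> x _; rewrite mulr_ge0 ?expR_ge0 ?subr_ge0 ?cos_le1.
- move=> x; apply: cvgM.
    apply: cvgB; first exact: cvg_cst.
    apply: (@continuous_comp _ _ _ ( *%R t) cos); last exact: continuous_cos.
    by apply: cvgM => //; exact: cvg_cst.
  apply: (@continuous_comp _ _ _ (fun x => - (s * x)) expR).
    by apply: cvgN; apply: cvgM => //; exact: cvg_cst.
  exact: continuous_expR.
- pose C := (s + `|t|) / (s ^+ 2 + t ^+ 2) + s^-1.
  have AC x : `|A x| <= C.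
    rewrite /A /C (le_trans (ler_normB _ _))// normfV (gtr0_norm s0) lerD2r//.
    rewrite normrM normfV (@ger0_norm _ (s ^+ 2 + t ^+ 2)) ?addr_ge0 ?sqr_ge0//.
    apply: ler_wpM2r; first by rewrite invr_ge0 addr_ge0 ?sqr_ge0.
    rewrite (le_trans (ler_normB _ _))// !normrM (gtr0_norm s0).
    rewrite lerD// -[leRHS]mulr1 ler_wpM2l// ?(ltW s0)// ler_norml.
      by rewrite cos_geN1 cos_le1.
    by rewrite sin_geN1 sin_le1.
  apply: (@squeeze_cvgr _ _ _ _ (fun x => - C * expR (- (s * x)))
     (fun x => C * expR (- (s * x)))).
  + near=> x; rewrite mulNr -ler_norml normrM ger0_norm ?expR_ge0// mulrC.
    by rewrite ler_wpM2r ?expR_ge0.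
  + by rewrite -(mulr0 (- C)); apply: cvgMl_tmp; exact: expRN_cvg0.
  + by rewrite -(mulr0 C); apply: cvgMl_tmp; exact: expRN_cvg0.
Unshelve. all: by end_near. Qed.

(** The Lorentzian left after multiplying the value of [integral_onemcos_expRN] by s. Its primitive
    |t| atan(s / |t|) requires the case t = 0 to be treated apart. *)
Lemma integral_lorentz t :
  (\int[mu]_(s in `[0%R, +oo[) (t ^+ 2 / (s ^+ 2 + t ^+ 2))%:E =
   (`|t| * (pi / 2))%:E)%E.
Proof.
have [->|t0] := eqVneq t 0.
  rewrite normr0 mul0r expr0n/=; apply: integral0_eq => s _.
  by rewrite mul0r.
have nt0 : 0 < `|t| by rewrite normr_gt0.
rewrite -real_normK ?num_real//.
have [u -> u0] : exists2 u : R, `|t| = u & 0 < u by exists `|t|.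
pose F s := u * atan (s / u).
have su s : s ^+ 2 + u ^+ 2 != 0 by rewrite gt_eqF// ltr_wpDl ?exprn_gt0 ?sqr_ge0.
have dF s : is_derive s 1 F (u ^+ 2 / (s ^+ 2 + u ^+ 2)).
  have su' : 1 + (s / u) ^+ 2 != 0 by rewrite gt_eqF// ltr_pwDl ?sqr_ge0.
  apply: is_derive_eq; rewrite /GRing.scale/=.
  field.
  by rewrite su gt_eqF.
rewrite (@ge0_FTC2y _ F 0 (u * (pi / 2)) _ _ dF) /F.
- by rewrite mul0r atan0 mulr0 subr0.
- by move=> s _; rewrite divr_ge0 ?addr_ge0 ?sqr_ge0.
- move=> s; apply: cvgM; first exact: cvg_cst.
  apply: cvgV => //; apply: cvgD; last exact: cvg_cst.
  exact: exprn_continuous.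
- apply: cvgMl_tmp.
  apply: (@cvg_comp _ _ _ (fun s => s / u) (@atan R) _ +oo).
    rewrite (_ : (fun s => s / u) = (fun s => u^-1 * s)); last first.
      by apply/funext => s; rewrite mulrC.
    by apply: gt0_cvgMry; rewrite ?invr_gt0.
  exact: cvgy_atan.
Qed.

(** Removing the null point 0 leaves only x > 0, where the formulas that divide by x are valid; the
    indicator brings the integral to the whole line, the form in which Tonelli is applied. *)
Lemma integral_itv0y_indic (f : R -> R) : measurable_fun setT f ->
  (\int[mu]_(x in `[0%R, +oo[) (f x)%:E =
   \int[mu]_x (\1_`]0%R, +oo[ x * f x)%:E)%E.
Proof.
move=> mf; rewrite -integral_itv_obnd_cbnd; last first.
  by apply/measurable_EFinP; exact: measurable_funTS.
rewrite integral_mkcond; apply: eq_integral => x _.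
by rewrite patchE indicE; case: ifPn => _; rewrite ?mul1r ?mul0r.
Qed.

(** Continuity fails only at 0, where [0^-1 = 0], so the line is cut into that point and its open
    complement. *)
Lemma measurable_invr : measurable_fun setT (fun x : R => x^-1).
Proof.
rewrite -(setvU [set (0 : R)]); apply/measurable_funU => //.
  exact: measurableC.
split; last exact: measurable_fun_set1.
apply: open_continuous_measurable_fun.
  by rewrite openC; apply: accessible_closed_set1; apply: hausdorff_accessible; exact: Rhausdorff.
by move=> x; rewrite inE/= => /eqP x0; exact: inv_continuous.
Qed.

Lemma measurable_cosM t : measurable_fun setT (fun x => cos (t * x)).
Proof.
apply: continuous_measurable_fun => x.
apply: (@continuous_comp _ _ _ ( *%R t) cos); last exact: continuous_cos.
by apply: cvgM => //; exact: cvg_cst.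
Qed.

(* Writes x^-2 as the integral of s exp(-s x) over s > 0 and exchanges the
   integrals. *)
Lemma integral_onemcos_half t :
  (\int[mu]_(x in `[0%R, +oo[) ((1 - cos (t * x)) / x ^+ 2)%:E =
   (`|t| * (pi / 2))%:E)%E.
Proof.
pose I : set R := `]0%R, +oo[%classic.
have mI : measurable I by exact: measurable_itv.
have Igt x : x \in I -> 0 < x by rewrite inE /I/= in_itv/= andbT.
have mc : measurable_fun setT (fun x => 1 - cos (t * x)).
  by apply: measurable_funB => //; exact: measurable_cosM.
have mexp x : measurable_fun setT (fun s => expR (- (s * x))).
  apply: measurableT_comp => //; apply: measurableT_comp => //.
  exact: measurable_funM.
pose H (p : measurableTypeR R * measurableTypeR R) : R :=
  \1_I p.1 * (\1_I p.2 * ((1 - cos (t * p.1)) * (p.2 * expR (- (p.2 * p.1))))).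
have mH : measurable_fun setT H.
  apply: measurable_funM.
    by apply: measurableT_comp; [exact: measurable_indic|exact: measurable_fst].
  apply: measurable_funM.
    by apply: measurableT_comp; [exact: measurable_indic|exact: measurable_snd].
  apply: measurable_funM.
    by apply: (@measurableT_comp _ _ _ _ _ _ (fun x => 1 - cos (t * x)));
      [exact: mc|exact: measurable_fst].
  apply: measurable_funM; first exact: measurable_snd.
  apply: measurableT_comp => //; apply: measurableT_comp => //.
  by apply: measurable_funM; [exact: measurable_snd|exact: measurable_fst].
have H0 p : (0 <= (H p)%:E)%E.
  rewrite lee_fin /H !indicE.
  have [/Igt p1|_] := boolP (p.1 \in I); last by rewrite mul0r.
  rewrite mul1r; have [/Igt p2|_] := boolP (p.2 \in I); last by rewrite mul0r.
  by rewrite mul1r !mulr_ge0 ?expR_ge0 ?subr_ge0 ?cos_le1 ?(ltW p2).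
have mI2 : measurable_fun setT (\1_I : R -> R) by exact: measurable_indic.
have mxe x : measurable_fun setT (fun s => s * expR (- (s * x))).
  exact: measurable_funM.
have mxc s : measurable_fun setT (fun x => (1 - cos (t * x)) * expR (- (s * x))).
  by apply: measurable_funM => //; under eq_fun do rewrite mulrC; exact: mexp.
have := @fubini_tonelli _ _ _ _ R mu mu (EFin \o H) _ H0.
move=> /(_ _)/=; rewrite /H/=.
have -> : (\int[mu]_x \int[mu]_y (\1_I x * (\1_I y * ((1 - cos (t * x)) * (y * expR (- (y * x))))))%:E
   = \int[mu]_(x in `[0%R, +oo[) ((1 - cos (t * x)) / x ^+ 2)%:E)%E.
  rewrite integral_itv0y_indic; last first.
    apply: measurable_funM => //; apply: measurableT_comp; first exact: measurable_invr.
    exact: measurable_funX.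
  apply: eq_integral => x _; rewrite indicE; have [/Igt x0|_] := boolP (x \in I); last first.
    by rewrite mul0r; apply: integral0_eq => y _; rewrite mul0r.
  under eq_integral do rewrite mul1r.
  rewrite mul1r EFinM -integral_mul_expRN// integral_itv0y_indic//.
  rewrite -ge0_integralZl_EFin//.
  - by apply: eq_integral => y _; rewrite -EFinM; congr EFin; rewrite /I/=; ring.
  - move=> y _; rewrite lee_fin indicE; have [/Igt y0|_] := boolP (y \in I).
      by rewrite mul1r mulr_ge0 ?expR_ge0 ?(ltW y0).
    by rewrite mul0r.
  - by apply/measurable_EFinP; apply: (measurable_funM mI2 (mxe x)).
have -> : (\int[mu]_y \int[mu]_x (\1_I x * (\1_I y * ((1 - cos (t * x)) * (y * expR (- (y * x))))))%:E
   = \int[mu]_(s in `[0%R, +oo[) (t ^+ 2 / (s ^+ 2 + t ^+ 2))%:E)%E.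
  rewrite integral_itv0y_indic; last first.
    apply: measurable_funM => //; apply: measurableT_comp; first exact: measurable_invr.
    by apply: measurable_funD => //; exact: measurable_funX.
  apply: eq_integral => y _; rewrite [in RHS]indicE.
  under eq_integral do rewrite [X in _ * (X * _)]indicE.
  have [/Igt y0|_] := boolP (y \in I); last first.
    by rewrite mul0r; apply: integral0_eq => x _; rewrite mul0r mulr0.
  under eq_integral do rewrite mul1r.
  rewrite mul1r.
  have -> : t ^+ 2 / (y ^+ 2 + t ^+ 2) = y * (t ^+ 2 / (y * (y ^+ 2 + t ^+ 2))).
    have yt : y ^+ 2 + t ^+ 2 != 0 by rewrite gt_eqF// ltr_pwDl ?exprn_gt0 ?sqr_ge0.
    by field; rewrite yt gt_eqF.
  rewrite EFinM -integral_onemcos_expRN// integral_itv0y_indic//.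
  rewrite -ge0_integralZl_EFin//.
  - by apply: eq_integral => z _; rewrite -EFinM; congr EFin; rewrite /I/=; ring.
  - by apply/measurable_EFinP; apply: (measurable_funM mI2 (mxc y)).
  - exact: ltW.
move=> ->; first exact: integral_lorentz.
exact/measurable_EFinP.
Qed.

Lemma ge0_integral_even (f : R -> R) : measurable_fun setT f ->
  (forall x, 0 <= f x) -> (forall x, f (- x) = f x) ->
  (\int[mu]_x (f x)%:E = 2%:E * \int[mu]_(x in `[0%R, +oo[) (f x)%:E)%E.
Proof.
move=> mf f0 fN.
have mEf D : measurable_fun D (EFin \o f).
  by apply/measurable_EFinP; exact: measurable_funTS.
have <- : `]-oo, 0] `|` `]0, +oo[ = [set: R].
  by rewrite -setCitvl setUv.
rewrite ge0_integral_setU//=.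
- rewrite integral_itv_obnd_cbnd// mule_natl mule2n; congr (_ + _)%E.
  rewrite (@ge0_integration_by_substitution0 _ (EFin \o f))//.
  by apply: eq_integral => x _ /=; rewrite fN.
- exact: mEf.
- by move=> x _; rewrite lee_fin.
- by apply/disj_set2P; rewrite -setCitvl setICr.
Qed.

Lemma integral_onemcos t :
  (\int[mu]_x ((1 - cos (t * x)) / x ^+ 2)%:E = (`|t| * pi)%:E)%E.
Proof.
rewrite (@ge0_integral_even (fun x => (1 - cos (t * x)) / x ^+ 2)).
- by rewrite integral_onemcos_half -EFinM; congr EFin; field.
- apply: measurable_funM.
    by apply: measurable_funB => //; exact: measurable_cosM.
  by apply: measurableT_comp; [exact: measurable_invr|exact: measurable_funX].
- by move=> x; rewrite divr_ge0 ?sqr_ge0 ?subr_ge0 ?cos_le1.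
- by move=> x; rewrite mulrN cosN sqrrN.
Qed.

End CosineIntegral.

(** * Gram functions of bounded kernels *)

Lemma measurable_comp_pair d d1 d2 d3 (T : measurableType d)
    (T1 : measurableType d1) (T2 : measurableType d2) (T3 : measurableType d3)
    (k : T1 * T2 -> T3) (f : T -> T1) (g : T -> T2) :
  measurable_fun setT k -> measurable_fun setT f -> measurable_fun setT g ->
  measurable_fun setT (fun q => k (f q, g q)).
Proof.
move=> mk mf mg; apply: (measurableT_comp mk).
by apply/measurable_fun_pairP; split.
Qed.

Lemma integrable_fubini_G d1 d2 (T1 : measurableType d1) (T2 : measurableType d2)
    (R : realType) (m1 : {sigma_finite_measure set T1 -> \bar R})
    (m2 : {sigma_finite_measure set T2 -> \bar R}) (f : T1 * T2 -> \bar R) :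
  (m1 \x m2)%E.-integrable setT f -> m2.-integrable setT (fubini_G m1 f).
Proof.
move=> iF; have mf := measurable_int _ iF.
apply/integrableP; split; first exact: (measurable_fubini_G iF).
have := (@integrable21ltyP _ _ _ _ _ m1 m2 f mf).1 iF; apply: le_lt_trans.
have mG : measurable_fun setT (fubini_G m1 f) by exact: (measurable_fubini_G iF).
apply: ge0_le_integral => //.
- exact: measurableT_comp.
- by apply: (@measurable_fun_fubini_tonelli_G _ _ _ _ _ m1 (abse \o f));
    [exact: measurableT_comp|move=> p; exact: abse_ge0].
- by move=> y _; apply: le_abse_integral => //; exact: measurableT_comp.
Qed.

Section Gram.
Context d1 d2 (X : measurableType d1) (Z : measurableType d2) (R : realType).
Variables (m : {sigma_finite_measure set X -> \bar R})
          (nu : {sigma_finite_measure set Z -> \bar R}).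

Lemma integrable_tensor (u v : X -> R) :
  m.-integrable setT (EFin \o u) -> m.-integrable setT (EFin \o v) ->
  (m \x m)%E.-integrable setT (fun p => (u p.1 * v p.2)%:E).
Proof.
move=> iu iv.
have mu := measurable_int _ iu; have mv := measurable_int _ iv.
have muv : measurable_fun setT (fun p : X * X => (u p.1 * v p.2)%:E).
  apply/measurable_EFinP; apply: measurable_funM.
    by apply: measurableT_comp; [exact/measurable_EFinP|exact: measurable_fst].
  by apply: measurableT_comp; [exact/measurable_EFinP|exact: measurable_snd].
have mnv : measurable_fun setT (fun x => `|v x|%:E).
  by apply/measurable_EFinP; apply: measurableT_comp => //; exact/measurable_EFinP.
apply/integrable12ltyP => //.
have /integrableP[_ uoo] := iu; have /integrableP[_ voo] := iv.
rewrite (eq_integral (fun x => (`|u x|%:E * \int[m]_y `|v y|%:E)%E)).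
  rewrite ge0_integralZr//.
  - by apply: lte_mul_pinfty; [exact: integral_ge0|rewrite ge0_fin_numE//; exact: integral_ge0|].
  - by apply/measurable_EFinP; apply: measurableT_comp => //; exact/measurable_EFinP.
  - exact: integral_ge0.
move=> x _; rewrite -ge0_integralZl_EFin//.
by apply: eq_integral => y _; rewrite abse_EFin/= normrM EFinM.
Qed.

Lemma integral_tensor (u v : X -> R) :
  m.-integrable setT (EFin \o u) -> m.-integrable setT (EFin \o v) ->
  (\int[m \x m]_p (u p.1 * v p.2)%:E = (\int[m]_x u x * \int[m]_x v x)%R%:E)%E.
Proof.
move=> iu iv.
rewrite -integral12_prod_meas1; last exact: integrable_tensor.
rewrite /fubini_F/=.
transitivity (\int[m]_x ((u x)%:E * (\int[m]_y v y)%R%:E))%E.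
  apply: eq_integral => x _.
  under eq_integral do rewrite EFinM.
  rewrite integralZl//; congr (_ * _)%E.
  by rewrite /Rintegral fineK//; exact: integrable_fin_num.
rewrite integralZr// EFinM; congr (_ * _)%E.
by rewrite /Rintegral fineK//; exact: integrable_fin_num.
Qed.

(** The two bounds act in different variables: [kB], at fixed z, makes x |-> a(x) k(z, x)
    integrable; [kM], an L^2 bound in z uniform in x, makes the triple integral behind the Gram
    identity absolutely convergent. *)
Variables (k : Z * X -> R) (a : X -> R) (B : Z -> R) (M : R).
Hypothesis mk : measurable_fun setT k.
Hypothesis ia : m.-integrable setT (EFin \o a).
Hypothesis kB : forall z x, `|k (z, x)| <= B z.
Hypothesis kM : forall x, (\int[nu]_z (k (z, x) ^+ 2)%:E <= M%:E)%E.

Let ma : measurable_fun setT a.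
Proof. by apply/measurable_EFinP; exact: measurable_int ia. Qed.

Let mkx x : measurable_fun setT (fun z => k (z, x)).
Proof. exact: measurableT_comp. Qed.

Let mkz z : measurable_fun setT (fun x => k (z, x)).
Proof. exact: measurableT_comp. Qed.

(** From |u v| <= (u^2 + v^2) / 2, each half contributing at most M / 2. *)
Let kkM x y : (\int[nu]_z `|k (z, x) * k (z, y)|%:E <= M%:E)%E.
Proof.
have mk2 w : measurable_fun setT (fun z => (2^-1 * k (z, w) ^+ 2)%:E).
  by apply/measurable_EFinP; apply: measurable_funM => //; exact: measurable_funX.
apply: (@le_trans _ _ (\int[nu]_z ((2^-1 * k (z, x) ^+ 2)%:E + (2^-1 * k (z, y) ^+ 2)%:E)))%E.
  apply: ge0_le_integral => //.
  - apply/measurable_EFinP; apply: measurableT_comp => //.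
    exact: measurable_funM.
  - exact: emeasurable_funD.
  - move=> z _; rewrite -EFinD lee_fin normrM -2!(real_normK (num_real (k _))).
    by have := sqr_ge0 (`|k (z, x)| - `|k (z, y)|); nra.
rewrite ge0_integralD//; last 2 first.
  by move=> z _; rewrite lee_fin mulr_ge0// sqr_ge0.
  by move=> z _; rewrite lee_fin mulr_ge0// sqr_ge0.
under eq_integral do rewrite EFinM.
under [X in (_ + X)%E]eq_integral do rewrite EFinM.
rewrite !ge0_integralZl_EFin//; try by [move=> z _; rewrite lee_fin sqr_ge0 |
  apply/measurable_EFinP; exact: measurable_funX].
apply: (@le_trans _ _ (2^-1%:E * M%:E + 2^-1%:E * M%:E)%E).
  by apply: leeD; apply: lee_wpmul2l.
by rewrite -!EFinM -EFinD lee_fin; lra.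
Qed.

Lemma gram_kernel_integrable x y : nu.-integrable setT (fun z => (k (z, x) * k (z, y))%:E).
Proof.
apply/integrableP; split.
  by apply/measurable_EFinP; exact: measurable_funM.
by apply: le_lt_trans (kkM x y) _; exact: ltry.
Qed.

Let iak z : m.-integrable setT (fun x => (a x * k (z, x))%:E).
Proof.
apply: (@le_integrable _ _ _ m setT _ _ (fun x => ((B z)%:E * (a x)%:E)%E)) => //.
- by apply/measurable_EFinP; exact: measurable_funM.
- move=> x _ /=; rewrite lee_fin !normrM mulrC ler_wpM2r//.
  by rewrite (le_trans (kB _ _))// ler_norm.
- exact: integrableZl.
Qed.

Let W (q : Z * (X * X)) : R := a q.2.1 * a q.2.2 * (k (q.1, q.2.1) * k (q.1, q.2.2)).

Let mW : measurable_fun setT (EFin \o W).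
Proof.
have m21 : measurable_fun setT (fun q : Z * (X * X) => q.2.1).
  by apply: measurableT_comp; [exact: measurable_fst|exact: measurable_snd].
have m22 : measurable_fun setT (fun q : Z * (X * X) => q.2.2).
  by apply: measurableT_comp; [exact: measurable_snd|exact: measurable_snd].
apply/measurable_EFinP; apply: measurable_funM; apply: measurable_funM.
- exact: (measurableT_comp ma).
- exact: (measurableT_comp ma).
- by apply: (measurable_comp_pair mk).
- by apply: (measurable_comp_pair mk).
Qed.

Let M0 (x : X) : 0 <= M.
Proof. by rewrite -lee_fin (le_trans _ (kM x))//; apply: integral_ge0 => z _; rewrite lee_fin sqr_ge0. Qed.

(** Integrating |W| in z first leaves at most M |a(x) a(y)|, which is integrable on the product. *)
Let iW : (nu \x (m \x m))%E.-integrable setT (EFin \o W).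
Proof.
apply/(@integrable21ltyP _ _ _ _ _ nu (sf_prod m m)) => /=; first exact: mW.
have ia2 := integrable_tensor ia ia.
have /integrableP[ma2 ia2oo] := ia2.
apply: (@le_lt_trans _ _ (\int[m \x m]_p (`|(a p.1 * a p.2)%:E| * M%:E))%E).
  apply: ge0_le_integral => //.
  - by move=> p _; exact: integral_ge0.
  - apply: (@measurable_fun_fubini_tonelli_G _ _ _ _ _ nu (abse \o (EFin \o W))) => //.
    by apply: measurableT_comp => //; exact: mW.
    by move=> p; exact: abse_ge0.
  - by apply: emeasurable_funM => //; exact: measurableT_comp.
  - move=> p _; under eq_integral do rewrite /W/= normrM EFinM.
    rewrite ge0_integralZl_EFin//; last first.
      apply/measurable_EFinP; apply: measurableT_comp => //; exact: measurable_funM.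
    by rewrite abse_EFin; apply: lee_wpmul2l; rewrite ?lee_fin.
(* [M0] gets 0 <= M from a point of X; when X is empty the integral is 0 outright. *)
have [x0|nx] := pselect (exists x : X, True); last first.
  by rewrite integral0_eq// => p; case: nx; exists p.1.
rewrite ge0_integralZr//.
- by rewrite muleC; apply: lte_mul_pinfty; rewrite ?lee_fin ?(M0 (projT1 (cid x0))).
- exact: measurableT_comp.
- by rewrite lee_fin (M0 (projT1 (cid x0))).
Qed.

Let G (p : X * X) : R := \int[nu]_z (k (z, p.1) * k (z, p.2)).

Let GE p : (\int[nu]_z (W (z, p))%:E = (a p.1 * a p.2 * G p)%:E)%E.
Proof.
transitivity (\int[nu]_z ((a p.1 * a p.2)%:E * (k (z, p.1) * k (z, p.2))%:E))%E.
  by apply: eq_integral => z _; rewrite -EFinM.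
rewrite (@integralZl _ _ _ nu setT measurableT _ (gram_kernel_integrable p.1 p.2)) [RHS]EFinM.
congr (_ * _)%E; rewrite /G /Rintegral fineK//.
exact: (integrable_fin_num measurableT (gram_kernel_integrable p.1 p.2)).
Qed.

Lemma gram_integrable :
  (m \x m)%E.-integrable setT (fun p => (a p.1 * a p.2 *
     \int[nu]_z (k (z, p.1) * k (z, p.2)))%:E).
Proof.
have := @integrable_fubini_G _ _ _ _ _ nu (sf_prod m m) _ iW.
by apply: eq_integrable => // p _; rewrite -GE.
Qed.

(** The square of the inner integral is a double integral over X * X, and Fubini moves the
    z-integral inside. The right side sees [k] only through its Gram function, so kernels with equal
    Gram functions give equal left sides. *)
Lemma gram_integral :
  (\int[nu]_z ((\int[m]_x (a x * k (z, x))) ^+ 2)%:E =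
   \int[m \x m]_p (a p.1 * a p.2 * \int[nu]_z (k (z, p.1) * k (z, p.2)))%:E)%E.
Proof.
have := @Fubini _ _ _ _ _ nu (sf_prod m m) _ iW.
move=> /= FE.
transitivity (\int[nu]_z \int[m \x m]_p (W (z, p))%:E)%E.
  apply: eq_integral => z _.
  rewrite expr2 -(integral_tensor (iak z) (iak z)).
  by apply: eq_integral => p _; congr EFin; rewrite /W/=; ring.
rewrite FE; apply: eq_integral => p _.
exact: GE.
Qed.

End Gram.

(** * Fatou and Cauchy-Schwarz in extended form *)

Section Generic.
Context d (T : measurableType d) (R : realType) (mu : {measure set T -> \bar R}).

Lemma limn_einf_le (u : (\bar R)^nat) (M : \bar R) :
  (forall n, (u n <= M)%E) -> (limn_einf u <= M)%E.
Proof.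
move=> uM; rewrite limn_einf_lim; apply: lime_le; first exact: is_cvg_einfs.
by near=> n; apply: le_trans (uM n); by apply: ereal_inf_lbound; exists n => /=.
Unshelve. all: by end_near. Qed.

(** Fatou for an almost everywhere limit: that limit agrees a.e. with the lower limit. The bound [M]
    may be +oo, which lets the same lemma serve functions that are not square integrable. *)
Lemma fatou_le (f_ : (T -> \bar R)^nat) (f : T -> \bar R) (M : \bar R) :
  (forall n, measurable_fun setT (f_ n)) -> (forall n x, (0 <= f_ n x)%E) ->
  measurable_fun setT f -> (forall x, (0 <= f x)%E) ->
  {ae mu, forall x, f_ n x @[n --> \oo] --> f x} ->
  (forall n, (\int[mu]_x f_ n x <= M)%E) -> (\int[mu]_x f x <= M)%E.
Proof.
move=> mf_ f_0 mf f0 cf fM.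
rewrite (@ge0_ae_eq_integral _ _ _ mu setT f (fun x => limn_einf (f_^~ x))) //.
- by apply: le_trans (fatou mu measurableT mf_ (fun n x _ => f_0 n x)) _; exact: limn_einf_le.
- rewrite (_ : (fun x => limn_einf (f_^~ x)) = (fun x => - limn_esup (fun n => - f_ n x))%E); last first.
    by apply/funext => x; rewrite limn_esupN oppeK.
  apply: measurableT_comp => //; apply: measurable_fun_limn_esup => // n.
  exact: measurableT_comp.
- move=> x _; rewrite limn_einf_lim; apply: lime_ge; first exact: is_cvg_einfs.
  by apply: nearW => n; apply: le_ereal_inf_tmp => _ [k _ <-].
- by move: cf; apply: filterS => x /cvg_limn_einf_sup[-> _] _.
Qed.

Lemma poweR2 (x : \bar R) : (0 <= x)%E -> (x `^ 2 = x * x)%E.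
Proof.
case: x => [r| |]//= r0; first by rewrite powR_mulrn.
by rewrite pnatr_eq0/= mulyy.
Qed.

Lemma sqr_Lnorm2 (f : T -> R) : measurable_fun setT f ->
  ('N[mu]_2%:E[EFin \o f] * 'N[mu]_2%:E[EFin \o f] = \int[mu]_x (f x ^+ 2)%:E)%E.
Proof.
move=> mf; rewrite -poweR2 ?Lnorm_ge0// poweR_Lnorm//.
apply: eq_integral => x _ /=.
by rewrite powR_mulrn// real_normK// num_real.
Qed.

(** Hoelder with exponents 2 and 2, squared so that only integrals in [0, +oo] occur and no square
    roots. *)
Lemma cauchy_schwarz (f g : T -> R) :
  measurable_fun setT f -> measurable_fun setT g ->
  ((\int[mu]_x `|f x * g x|%:E) * (\int[mu]_x `|f x * g x|%:E) <=
   (\int[mu]_x (f x ^+ 2)%:E) * (\int[mu]_x (g x ^+ 2)%:E))%E.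
Proof.
move=> mf mg.
have h2 : (2^-1 + 2^-1 : R) = 1 by lra.
have p2 : 0 < 2 :> R by [].
have := hoelder mu mf mg p2 p2 h2.
rewrite Lnorm1 => H.
rewrite -!sqr_Lnorm2// muleACA.
by apply: lee_pmul => //; apply: integral_ge0.
Qed.

End Generic.

(** * The sinc and box kernels and their Gram functions *)

Section Kernel.
Context (R : realType).
Local Notation mu := (@lebesgue_measure R).
Implicit Types (s t x y z h : R).

Lemma derive_seq (f : R -> R) x l (u : nat -> R) : is_derive x 1 f l ->
  u n @[n --> \oo] --> 0 -> (forall n, u n != 0) ->
  (f (x + u n) - f x) / u n @[n --> \oo] --> l.
Proof.
move=> [df <-] u0 un0.
have : h^-1 *: ((f \o shift x) (h *: 1) - f x) @[h --> 0^'] --> 'D_1 f x by [].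
set g := (X in X @ _ --> _) => H.
rewrite (_ : (fun n => _) = g \o u); last first.
  by apply/funext => n /=; rewrite /g /GRing.scale/= mulr1 [LHS]mulrC (addrC x).
apply: cvg_comp H; move=> A; rewrite /nbhs/= /dnbhs/= => H.
have H' := u0 _ H.
near=> n; have : (u @^-1` (fun y => y != 0 -> A y)) n by near: n; exact: H'.
by apply.
Unshelve. all: by end_near. Qed.

Lemma measurable_onemcos t : measurable_fun setT (fun x => (1 - cos (t * x)) / x ^+ 2).
Proof.
apply: measurable_funM.
  by apply: measurable_funB => //; exact: measurable_cosM.
by apply: measurableT_comp; [exact: measurable_invr|exact: measurable_funX].
Qed.

Lemma onemcos_ge0 t x : 0 <= (1 - cos (t * x)) / x ^+ 2.
Proof. by rewrite divr_ge0 ?sqr_ge0 ?subr_ge0 ?cos_le1. Qed.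

Lemma integrable_onemcos t :
  mu.-integrable setT (EFin \o (fun x => (1 - cos (t * x)) / x ^+ 2)).
Proof.
apply/integrableP; split.
  by apply/measurable_EFinP; exact: measurable_onemcos.
under eq_integral do rewrite gee0_abs ?lee_fin ?onemcos_ge0//.
by rewrite integral_onemcos ltry.
Qed.

Lemma Rintegral_onemcos t : \int[mu]_x ((1 - cos (t * x)) / x ^+ 2) = `|t| * pi.
Proof. by rewrite /Rintegral integral_onemcos. Qed.

(** The Fourier transform of the indicator of [-h/2, h/2], except at x = 0, where division by zero
    gives 0 instead of h. *)
Definition sinc_kernel h x := sin (pi * h * x) / (pi * x).

(** The formula 2 sin^2 a = 1 - cos(2 a) turns the product into a second difference in t. Writing it
    with 1 - cos instead of cos makes each of the three terms integrable on its own. *)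
Lemma sinc_cosE h t x : sinc_kernel h x ^+ 2 * cos (2 * pi * t * x) =
  (4 * pi ^+ 2)^-1 *
    ((1 - cos ((2 * pi * (t + h)) * x)) / x ^+ 2 +
     (1 - cos ((2 * pi * (t - h)) * x)) / x ^+ 2 -
     2 * ((1 - cos ((2 * pi * t) * x)) / x ^+ 2)).
Proof.
have pi0 : pi != 0 :> R by rewrite gt_eqF// pi_gt0.
rewrite /sinc_kernel.
set b := 2 * pi * t * x; set a := pi * h * x.
have -> : 2 * pi * (t + h) * x = b + (a + a) by rewrite /a /b; ring.
have -> : 2 * pi * (t - h) * x = b - (a + a) by rewrite /a /b; ring.
rewrite cosD cosB cosD sinD invfM -exprVn; move: (x^-1) => v.
have -> : cos a * cos a = 1 - sin a ^+ 2 by rewrite -(cos2Dsin2 a); ring.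
move: (pi : R) pi0 => c c0.
by field.
Qed.

Lemma integrable_sinc_cos h t :
  mu.-integrable setT (EFin \o (fun x => sinc_kernel h x ^+ 2 * cos (2 * pi * t * x))).
Proof.
under eq_fun do rewrite sinc_cosE.
have iD r : mu.-integrable setT (EFin \o (fun x => (1 - cos (r * x)) / x ^+ 2)).
  exact: integrable_onemcos.
apply: (@integrableZl _ _ _ mu setT measurableT (4 * pi ^+ 2)^-1 (EFin \o (fun x =>
    ((1 - cos ((2 * pi * (t + h)) * x)) / x ^+ 2 +
     (1 - cos ((2 * pi * (t - h)) * x)) / x ^+ 2 -
     2 * ((1 - cos ((2 * pi * t) * x)) / x ^+ 2))))).
apply: (@integrableB _ _ _ mu setT measurableT
  (EFin \o (fun x => ((1 - cos ((2 * pi * (t + h)) * x)) / x ^+ 2 +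
     (1 - cos ((2 * pi * (t - h)) * x)) / x ^+ 2)))
  (EFin \o (fun x => 2 * ((1 - cos ((2 * pi * t) * x)) / x ^+ 2)))).
  exact: (integrableD measurableT (iD _) (iD _)).
exact: (integrableZl measurableT _ (iD _)).
Qed.

(** Each term contributes |2 pi r| pi / (4 pi^2) = |r| / 2. For h >= 0 the result is the triangle
    max(h - |t|, 0). *)
Lemma Rintegral_sinc_cos h t :
  \int[mu]_x (sinc_kernel h x ^+ 2 * cos (2 * pi * t * x)) =
  (`|t + h| + `|t - h| - 2 * `|t|) / 2.
Proof.
have pi0 : pi != 0 :> R by rewrite gt_eqF// pi_gt0.
have iD r : mu.-integrable setT (EFin \o (fun x => (1 - cos (r * x)) / x ^+ 2)).
  exact: integrable_onemcos.
have i1 : mu.-integrable setT (EFin \o (fun x => ((1 - cos ((2 * pi * (t + h)) * x)) / x ^+ 2 +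
     (1 - cos ((2 * pi * (t - h)) * x)) / x ^+ 2))).
  exact: (integrableD measurableT (iD _) (iD _)).
have i2 : mu.-integrable setT (EFin \o (fun x => 2 * ((1 - cos ((2 * pi * t) * x)) / x ^+ 2))).
  exact: (integrableZl measurableT _ (iD _)).
under eq_Rintegral do rewrite sinc_cosE.
rewrite RintegralZl//; last exact: (integrableB measurableT i1 i2).
rewrite RintegralB// RintegralD// RintegralZl// !Rintegral_onemcos.
rewrite !normrM !(ger0_norm (ltW (pi_gt0 R))) ger0_norm//.
move: (pi : R) pi0 => c c0.
by field.
Qed.

(** As a condition on x this reads x in []z, z + h]], so integrating [a] against it gives the
    increment of a primitive of [a] over [z, z + h]. *)
Definition box_kernel h z x : R := if (x - h <= z) && (z < x) then 1 else 0.

(** For x <= y the intervals [x - h, x) and [y - h, y) overlap in [y - h, x), of length max(h - |x -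
    y|, 0). *)
Lemma box_kernel_gram h x y : 0 < h ->
  (\int[mu]_z (box_kernel h z x * box_kernel h z y)%:E =
  ((`|x - y + h| + `|x - y - h| - 2 * `|x - y|) / 2)%:E)%E.
Proof.
move=> h0; wlog : x y / x <= y.
  move=> H; have [xy|/ltW yx] := leP x y; first exact: H.
  under eq_integral do rewrite mulrC.
  rewrite H//; congr EFin; rewrite -(distrC x y).
  rewrite -(normrN (y - x + h)) -(normrN (y - x - h)).
  rewrite (_ : - (y - x + h) = x - y - h); last by lra.
  by rewrite (_ : - (y - x - h) = x - y + h); lra.
move=> xy.
transitivity (mu `[y - h, x[%classic).
  rewrite -[X in _ = mu X]setIT -integral_indic//.
  apply: eq_integral => z _.
  rewrite /box_kernel indicE mem_setE in_itv/=.
  rewrite (_ : (y - h <= z < x) = (x - h <= z < x) && (y - h <= z < y)).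
    by case: (_ <= z < x); case: (_ <= z < y); rewrite ?mulr1 ?mulr0.
  apply/andP/andP => [[? ?]|[/andP[? ?] /andP[? ?]]]; last by split.
  by split; apply/andP; split; lra.
rewrite lebesgue_measure_itv/= lte_fin.
have -> : `|x - y| = y - x by rewrite distrC ger0_norm ?subr_ge0.
have -> : `|x - y - h| = y - x + h by rewrite ler0_norm; lra.
case: ltP => yh.
  by rewrite ger0_norm; [congr EFin; lra|lra].
by rewrite ler0_norm; [congr EFin; lra|lra].
Qed.

End Kernel.

(** * Plancherel for real functions on the line *)

(** The extended integral is by definition the difference of those of the positive and negative
    parts, each measurable in z by Tonelli; [fine] preserves measurability, also where the
    difference is infinite. *)
Lemma measurable_Rintegral_param d1 d2 (X : measurableType d1) (Z : measurableType d2)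
    (R : realType) (m : {sigma_finite_measure set X -> \bar R}) (k : Z * X -> R) :
  measurable_fun setT k -> measurable_fun setT (fun z => \int[m]_x k (z, x)).
Proof.
move=> mk; have mEk : measurable_fun setT (EFin \o k) by exact/measurable_EFinP.
apply: measurableT_comp => //.
rewrite (_ : (fun z => _) = (fun z => \int[m]_x (EFin \o k)^\+ (z, x) -
   \int[m]_x (EFin \o k)^\- (z, x))%E); last first.
  apply/funext => z; rewrite integralE.
  by congr (_ - _)%E; apply: eq_integral => x _; rewrite ?funeposE ?funenegE.
apply: emeasurable_funB; apply: measurable_fun_fubini_tonelli_F => //.
- exact: measurable_funepos.
- exact: measurable_funeneg.
Qed.

Lemma cvg_sqr (R : realType) (v : nat -> R) (l : R) :
  v n @[n --> \oo] --> l -> v n ^+ 2 @[n --> \oo] --> l ^+ 2.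
Proof. by move=> vl; rewrite expr2; under eq_fun do rewrite expr2; exact: cvgM. Qed.

Lemma sqr_Rintegral_le d (T : measurableType d) (R : realType)
    (m : {measure set T -> \bar R}) (u : T -> R) :
  m.-integrable setT (EFin \o u) ->
  (((\int[m]_x u x) ^+ 2)%:E <=
    (\int[m]_x `|u x|%:E) * (\int[m]_x `|u x|%:E))%E.
Proof.
move=> iu; rewrite -real_normK ?num_real// expr2 EFinM.
have H : (`|\int[m]_x u x|%:E <= \int[m]_x `|u x|%:E)%E.
  rewrite EFin_normr_Rintegral//; apply: le_abse_integral => //.
  exact: measurable_int iu.
by apply: lee_pmul => //; rewrite lee_fin.
Qed.

Section RealPlancherel.
Context (R : realType) (a : R -> R).
Local Notation mu := (@lebesgue_measure R).
Hypothesis ia : mu.-integrable setT (EFin \o a).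
Implicit Types (x y z h : R).

Let ma : measurable_fun setT a.
Proof. by apply/measurable_EFinP; exact: measurable_int ia. Qed.

Definition cos_transform y := \int[mu]_x (a x * cos (2 * pi * (y * x))).
Definition sin_transform y := \int[mu]_x (a x * sin (2 * pi * (y * x))).

Let mphase (f : R -> R) : continuous f ->
  measurable_fun setT (fun p : measurableTypeR R * measurableTypeR R => f (2 * pi * (p.1 * p.2))).
Proof.
move=> cf; apply: (measurableT_comp (continuous_measurable_fun cf)).
by apply: measurable_funM => //; apply: measurable_funM; [exact: measurable_fst|exact: measurable_snd].
Qed.

Let ibounded (f : R -> R) : measurable_fun setT f -> (forall x, `|f x| <= 1) ->
  mu.-integrable setT (EFin \o (fun x => a x * f x)).
Proof.
move=> mf f1; apply: (le_integrable measurableT _ _ ia).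
  by apply/measurable_EFinP; exact: measurable_funM.
by move=> x _ /=; rewrite lee_fin normrM ler_piMr.
Qed.

Let cos1 x : `|cos x| <= 1 :> R.
Proof. exact: cos_max. Qed.

Let sin1 x : `|sin x| <= 1 :> R.
Proof. exact: sin_max. Qed.

Lemma measurable_cos_transform : measurable_fun setT cos_transform.
Proof.
apply: (@measurable_Rintegral_param _ _ _ _ _ mu
  (fun p : measurableTypeR R * measurableTypeR R => a p.2 * cos (2 * pi * (p.1 * p.2)))).
apply: measurable_funM; last exact: mphase (@continuous_cos R).
exact: (measurableT_comp ma).
Qed.

Lemma measurable_sin_transform : measurable_fun setT sin_transform.
Proof.
apply: (@measurable_Rintegral_param _ _ _ _ _ mu
  (fun p : measurableTypeR R * measurableTypeR R => a p.2 * sin (2 * pi * (p.1 * p.2)))).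
apply: measurable_funM; last exact: mphase (@continuous_sin R).
exact: (measurableT_comp ma).
Qed.

Let msinc h : measurable_fun setT (sinc_kernel h).
Proof.
apply: measurable_funM.
  apply: (measurableT_comp (continuous_measurable_fun (@continuous_sin R))).
  exact: measurable_funM.
by apply: measurableT_comp; [exact: measurable_invr|exact: measurable_funM].
Qed.

Let isinc2 h : 0 <= h -> (\int[mu]_x (sinc_kernel h x ^+ 2)%:E = h%:E)%E.
Proof.
move=> h0; have := Rintegral_sinc_cos h 0.
have := integrable_sinc_cos h 0.
have -> : (fun x => sinc_kernel h x ^+ 2 * cos (2 * pi * 0 * x)) =
    (fun x => sinc_kernel h x ^+ 2).
  by apply/funext => x; rewrite mulr0 mul0r cos0 mulr1.
rewrite /Rintegral => i e.
rewrite -[LHS]fineK ?e; last exact: integrable_fin_num.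
congr EFin.
by rewrite add0r sub0r normrN normr0 mulr0 subr0 ger0_norm//; lra.
Qed.

(** Taken with f = cos and f = sin: the real and imaginary parts, up to sign, of the complex
    modulated kernel, so that the Gram lemmas for real kernels apply. *)
Let sinc_mod h (f : R -> R) (p : measurableTypeR R * measurableTypeR R) : R :=
  sinc_kernel h p.1 * f (2 * pi * (p.1 * p.2)).

Let msinc_mod h f : continuous f -> measurable_fun setT (sinc_mod h f).
Proof.
move=> cf; apply: measurable_funM; last exact: mphase.
by apply: (measurableT_comp (msinc h)); exact: measurable_fst.
Qed.

Let sinc_modB h f : (forall x, `|f x| <= 1) -> forall z x,
  `|sinc_mod h f (z, x)| <= `|sinc_kernel h z|.
Proof. by move=> f1 z x; rewrite normrM ler_piMr. Qed.

Let sinc_modM h f : 0 <= h -> continuous f -> (forall x, `|f x| <= 1) ->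
  forall x, (\int[mu]_z (sinc_mod h f (z, x) ^+ 2)%:E <= h%:E)%E.
Proof.
move=> h0 cf f1 x; rewrite -isinc2//; apply: ge0_le_integral => //.
- by move=> z _; rewrite lee_fin sqr_ge0.
- apply/measurable_EFinP; apply: measurable_funX.
  exact: (measurableT_comp (msinc_mod h cf)).
- by apply/measurable_EFinP; apply: measurable_funX; exact: msinc.
- move=> z _; rewrite lee_fin -(real_normK (num_real (_ z))) -(real_normK (num_real _)).
  by rewrite ler_pXn2r ?nnegrE// sinc_modB.
Qed.

Let sinc_mod_transform h f z : continuous f -> (forall x, `|f x| <= 1) ->
  \int[mu]_x (a x * sinc_mod h f (z, x)) =
  sinc_kernel h z * \int[mu]_x (a x * f (2 * pi * (z * x))).
Proof.
move=> cf f1; rewrite -RintegralZl//.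
  by apply: eq_Rintegral => x _; rewrite /sinc_mod/=; ring.
apply: (@ibounded (fun x => f (2 * pi * (z * x)))) => //.
apply: (measurableT_comp (continuous_measurable_fun cf)).
by apply: measurable_funM => //; exact: measurable_funM.
Qed.

Let mbox h : measurable_fun setT
  (fun p : measurableTypeR R * measurableTypeR R => box_kernel h p.1 p.2).
Proof.
apply: measurable_fun_ifT => //; apply: measurable_and.
  apply: measurable_fun_ler; last exact: measurable_fst.
  by apply: measurable_funB => //; exact: measurable_snd.
by apply: measurable_fun_ltr; [exact: measurable_fst|exact: measurable_snd].
Qed.

Let box_sqr h z x : box_kernel h z x ^+ 2 = box_kernel h z x.
Proof. by rewrite /box_kernel; case: ifP; rewrite ?expr1n ?expr0n. Qed.

Let ibox h x : 0 < h -> (\int[mu]_z (box_kernel h z x ^+ 2)%:E = h%:E)%E.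
Proof.
move=> h0; under eq_integral do rewrite expr2.
rewrite box_kernel_gram//; congr EFin.
by rewrite subrr add0r sub0r normrN normr0 mulr0 subr0 gtr0_norm//; lra.
Qed.

(** The Gram functions of the cos and sin modulations add up, through cos u cos v + sin u sin v =
    cos(u - v), to the integral computed in [Rintegral_sinc_cos] at t = x - y, which is the Gram
    function of the box. *)
Lemma sinc_average h : 0 < h ->
  (\int[mu]_y (sinc_kernel h y ^+ 2 * (cos_transform y ^+ 2 + sin_transform y ^+ 2))%:E =
   \int[mu]_z ((\int[mu]_x (a x * box_kernel h z x)) ^+ 2)%:E)%E.
Proof.
move=> h0; have h0' := ltW h0.
have cc := @continuous_cos R; have cs := @continuous_sin R.
have m1 := msinc_mod h cc; have m2 := msinc_mod h cs.
have M1 := sinc_modM h0' cc cos1; have M2 := sinc_modM h0' cs sin1.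
have B1 := sinc_modB h cos1; have B2 := sinc_modB h sin1.
have Bb z x : `|box_kernel h z x| <= 1 by rewrite /box_kernel; case: ifP; rewrite ?normr1 ?normr0.
have Mb x : (\int[mu]_z (box_kernel h z x ^+ 2)%:E <= h%:E)%E by rewrite ibox.
rewrite (gram_integral (mbox h) ia Bb Mb)/=.
transitivity (\int[mu]_y ((\int[mu]_x (a x * sinc_mod h cos (y, x))) ^+ 2)%:E +
  \int[mu]_y ((\int[mu]_x (a x * sinc_mod h sin (y, x))) ^+ 2)%:E)%E.
  rewrite -ge0_integralD//.
  - apply: eq_integral => y _; rewrite !sinc_mod_transform// -EFinD; congr EFin.
    by rewrite -/(cos_transform y) -/(sin_transform y); ring.
  - by move=> y _; rewrite lee_fin sqr_ge0.
  - under eq_fun do rewrite sinc_mod_transform//.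
    apply/measurable_EFinP; apply: measurable_funX; apply: measurable_funM; first exact: msinc.
    exact: measurable_cos_transform.
  - by move=> y _; rewrite lee_fin sqr_ge0.
  - under eq_fun do rewrite sinc_mod_transform//.
    apply/measurable_EFinP; apply: measurable_funX; apply: measurable_funM; first exact: msinc.
    exact: measurable_sin_transform.
rewrite (gram_integral m1 ia B1 M1) (gram_integral m2 ia B2 M2).
rewrite -integralD//; last 2 first.
  exact: (gram_integrable m1 ia M1).
  exact: (gram_integrable m2 ia M2).
apply: eq_integral => -[x y] _ /=; rewrite -EFinD; congr EFin.
rewrite -mulrDr; congr (_ * _).
rewrite -RintegralD//; last 2 first.
  exact: (gram_kernel_integrable m1 M1).
  exact: (gram_kernel_integrable m2 M2).
rewrite [RHS]/Rintegral box_kernel_gram//= -Rintegral_sinc_cos.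
apply: eq_Rintegral => z _; rewrite /sinc_mod/=.
rewrite (_ : 2 * pi * (x - y) * z = 2 * pi * (z * x) - 2 * pi * (z * y)); last by ring.
by rewrite cosB; ring.
Qed.

(* The box has mass h in each variable separately: Cauchy-Schwarz in x, then
   Tonelli. *)
Lemma average_le h : 0 < h ->
  (\int[mu]_z ((\int[mu]_x (a x * box_kernel h z x)) ^+ 2)%:E <=
   (h ^+ 2)%:E * \int[mu]_x (a x ^+ 2)%:E)%E.
Proof.
move=> h0.
have mbz z : measurable_fun setT (box_kernel h z).
  exact: (measurableT_comp (mbox h) (measurable_pair1 z)).
have mbx x : measurable_fun setT (fun z => box_kernel h z x).
  exact: (measurableT_comp (mbox h) (measurable_pair2 x)).
have ibz z : (\int[mu]_x (box_kernel h z x ^+ 2)%:E <= h%:E)%E.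
  have -> : (\int[mu]_x (box_kernel h z x ^+ 2)%:E = mu `]z, (z + h)%R]%classic)%E.
    rewrite -[X in _ = mu X]setIT -integral_indic//.
    apply: eq_integral => x _.
    rewrite box_sqr /box_kernel indicE mem_setE in_itv/= lerBlDr andbC.
    by case: ifP.
  by rewrite lebesgue_measure_itv/= lte_fin ltrDl h0 -EFinD lee_fin; lra.
have ma2 : measurable_fun setT (fun x => (a x ^+ 2)%:E).
  by apply/measurable_EFinP; exact: measurable_funX.
pose H (p : measurableTypeR R * measurableTypeR R) := (a p.2 ^+ 2 * box_kernel h p.1 p.2)%:E.
have H0 p : (0 <= H p)%E.
  by rewrite lee_fin mulr_ge0 ?sqr_ge0// -box_sqr sqr_ge0.
have mH : measurable_fun setT H.
  apply/measurable_EFinP; apply: measurable_funM; last exact: mbox.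
  by apply: measurable_funX; exact: (measurableT_comp ma).
apply: (@le_trans _ _ (\int[mu]_z (h%:E * \int[mu]_x H (z, x)))%E).
  apply: ge0_le_integral => //.
  - by move=> z _; rewrite lee_fin sqr_ge0.
  - apply/measurable_EFinP; apply: measurable_funX.
    apply: (@measurable_Rintegral_param _ _ _ _ _ mu
      (fun p : measurableTypeR R * measurableTypeR R => a p.2 * box_kernel h p.1 p.2)).
    by apply: measurable_funM => //; exact: (measurableT_comp ma).
  - apply: measurable_funeM; exact: (@measurable_fun_fubini_tonelli_F _ _ _ _ _ mu H).
  - move=> z _.
    have -> : (\int[mu]_x (a x * box_kernel h z x))  =
       (\int[mu]_x ((a x * box_kernel h z x) * box_kernel h z x)).
      by apply: eq_Rintegral => x _; rewrite -mulrA -expr2 box_sqr.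
    have mab : measurable_fun setT (fun x => a x * box_kernel h z x) by exact: measurable_funM.
    have iabb : mu.-integrable setT (EFin \o (fun x => a x * box_kernel h z x * box_kernel h z x)).
      rewrite (_ : (fun x => a x * box_kernel h z x * box_kernel h z x) =
                   (fun x => a x * box_kernel h z x)).
        apply: ibounded => // x.
        by rewrite /box_kernel; case: ifP; rewrite ?normr1 ?normr0.
      by apply/funext => x; rewrite -mulrA -expr2 box_sqr.
    apply: (@le_trans _ _ ((\int[mu]_x (`|a x * box_kernel h z x * box_kernel h z x|)%:E) *
       (\int[mu]_x (`|a x * box_kernel h z x * box_kernel h z x|)%:E))%E).
      exact: sqr_Rintegral_le.
    apply: (le_trans (cauchy_schwarz mu mab (mbz z))).
    rewrite muleC; apply: lee_pmul => //; try by apply: integral_ge0 => x _; rewrite lee_fin sqr_ge0.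
    rewrite le_eqVlt; apply/orP; left; apply/eqP; apply: eq_integral => x _.
    by rewrite /H/= exprMn box_sqr.
rewrite ge0_integralZl//; last 3 first.
  exact: (@measurable_fun_fubini_tonelli_F _ _ _ _ _ mu H).
  by move=> z _; exact: integral_ge0.
  by rewrite lee_fin ltW.
rewrite (@fubini_tonelli _ _ _ _ _ mu mu H mH H0).
rewrite expr2 EFinM -muleA lee_wpmul2l ?lee_fin ?(ltW h0)//.
rewrite -ge0_integralZl//; last 2 first.
  by move=> x _; rewrite lee_fin sqr_ge0.
  by rewrite lee_fin ltW.
rewrite le_eqVlt; apply/orP; left; apply/eqP; apply: eq_integral => x _; rewrite /H/=.
under eq_integral do rewrite EFinM -box_sqr.
rewrite ge0_integralZl//.
- by rewrite ibox// muleC.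
- by apply/measurable_EFinP; apply: measurable_funX; exact: mbx.
- by move=> z _; rewrite lee_fin sqr_ge0.
- by rewrite lee_fin sqr_ge0.
Qed.

(** The average over []z, z + u n]] is a difference quotient of the primitive of [a] taken from -oo,
    which is differentiable with derivative [a z] for almost every z. *)
Lemma average_cvg (u : nat -> R) : (forall n, 0 < u n) -> u n @[n --> \oo] --> 0 ->
  {ae mu, forall z, (u n)^-1 * \int[mu]_x (a x * box_kernel (u n) z x) @[n --> \oo] --> a z}.
Proof.
move=> u_gt0 u0.
have iaS A : measurable A -> mu.-integrable A (EFin \o a).
  by move=> mA; exact: integrableS ia.
have loc : locally_integrable [set: R] a.
  by apply: open_integrable_locally => //; exact: openT.
have := FTC1Ny (fun y => iaS _ (measurable_itv `]-oo, y])) loc.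
apply: filterS; first exact: (ae_filter_ringOfSetsType mu).
move=> z /= [dF Fz].
pose F x := \int[mu]_(t in `]-oo, x]) a t.
have dFa : is_derive z 1 F (a z) by split; [exact: dF|rewrite -derive1E; exact: Fz].
have cF := derive_seq dFa u0 (fun n => lt0r_neq0 (u_gt0 n)).
rewrite (_ : (fun n => _) = (fun n => (F (z + u n) - F z) / u n)); first exact: cF.
apply/funext => n; rewrite mulrC; congr (_ / _).
have zz : (BRight z <= BRight (z + u n))%O by rewrite bnd_simp ltW// ltrDl.
rewrite /F Rintegral_itvB; [|exact: iaS|by []|exact: zz].
rewrite Rintegral_mkcond; apply: eq_Rintegral => x _.
rewrite patchE mem_setE in_itv/= /box_kernel lerBlDr andbC.
by case: ifP; rewrite ?mulr1 ?mulr0.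
Qed.

Lemma normr_sin_le x : `|sin x| <= `|x|.
Proof.
wlog x0 : x / 0 <= x.
  move=> H; have [|/ltW x0] := leP 0 x; first exact: H.
  by rewrite -normrN -sinN -[leRHS]normrN; apply: H; rewrite oppr_ge0.
move: x0; rewrite le_eqVlt => /predU1P[<-|x0]; first by rewrite sin0 normr0.
have [c _ ->] : exists2 c, c \in `]0, x[%R & sin x = cos c * x.
  have := @MVT R sin cos 0 x x0 (fun c _ => is_derive_sin c).
  rewrite subr0 sin0 subr0; apply.
  exact: continuous_subspaceT (@continuous_sin R).
by rewrite normrM ler_piMl.
Qed.

(** From |sin u| <= |u|. It makes the weight h^-2 [sinc_kernel]^2 at most 1, which yields the lower
    bound on the transform side of Plancherel. *)
Lemma sinc_kernel_le h y : 0 < h -> sinc_kernel h y ^+ 2 <= h ^+ 2.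
Proof.
move=> h0; rewrite -(real_normK (num_real (sinc_kernel h y))).
rewrite ler_pXn2r ?nnegrE// ?(ltW h0)//.
have [->|y0] := eqVneq y 0; first by rewrite /sinc_kernel !mulr0 invr0 mulr0 normr0 ltW.
rewrite /sinc_kernel normrM normfV ler_pdivrMr; last first.
  by rewrite normr_gt0 mulf_neq0// gt_eqF// pi_gt0.
rewrite (le_trans (normr_sin_le _))// !normrM (gtr0_norm h0).
by rewrite mulrAC mulrC.
Qed.

(** The weight is the square of a difference quotient of sin at 0, with increment pi y u_n. The
    point y = 0, where the kernel is 0 by convention, is excluded and is a null set later. *)
Lemma sinc_kernel_cvg (u : nat -> R) y : (forall n, 0 < u n) ->
  u n @[n --> \oo] --> 0 -> y != 0 ->
  (u n) ^- 2 * sinc_kernel (u n) y ^+ 2 @[n --> \oo] --> (1 : R).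
Proof.
move=> u_gt0 u0 y0.
have piy : pi * y != 0 by rewrite mulf_neq0// gt_eqF// pi_gt0.
pose v n := pi * y * u n.
have v0 : v n @[n --> \oo] --> 0.
  by rewrite -(mulr0 (pi * y)); exact: cvgMl_tmp.
have vn0 n : v n != 0 by rewrite mulf_neq0// gt_eqF.
have H := derive_seq (is_derive_sin 0) v0 vn0.
rewrite cos0 in H.
rewrite (_ : (fun n => _) = (fun n => ((sin (0 + v n) - sin 0) / v n) ^+ 2)); last first.
  apply/funext => n; rewrite sin0 subr0 add0r /v /sinc_kernel.
  rewrite (_ : pi * u n * y = pi * y * u n); last by ring.
  move: (sin (pi * y * u n)) (pi * y) piy => s c c0.
  field.
  by rewrite c0 gt_eqF.
by rewrite -(expr1n R 2); exact: cvg_sqr.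
Qed.

Lemma plancherel_real :
  (\int[mu]_y (cos_transform y ^+ 2 + sin_transform y ^+ 2)%:E =
   \int[mu]_x (a x ^+ 2)%:E)%E.
Proof.
(* A sequence of widths h, since Fatou is a statement about sequences. *)
pose u n : R := n.+1%:R^-1.
have u_gt0 n : 0 < u n by rewrite invr_gt0.
have u0 : u n @[n --> \oo] --> 0 by exact: cvg_harmonic.
have u2_gt0 n : 0 < (u n) ^- 2 by rewrite invr_gt0 exprn_gt0.
pose P y := cos_transform y ^+ 2 + sin_transform y ^+ 2.
have P0 y : 0 <= P y by rewrite addr_ge0 ?sqr_ge0.
have mP : measurable_fun setT P.
  apply: measurable_funD; apply: measurable_funX.
    exact: measurable_cos_transform.
  exact: measurable_sin_transform.
pose S n y := (u n) ^- 2 * (sinc_kernel (u n) y ^+ 2 * P y).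
have S0 n y : 0 <= S n y by rewrite mulr_ge0 ?(ltW (u2_gt0 n))// mulr_ge0 ?sqr_ge0 ?P0.
have mS n : measurable_fun setT (EFin \o S n).
  apply/measurable_EFinP; apply: measurable_funM => //; apply: measurable_funM => //.
  by apply: measurable_funX; exact: msinc.
have SE n : (\int[mu]_y (S n y)%:E =
    \int[mu]_z (((u n)^-1 * \int[mu]_x (a x * box_kernel (u n) z x)) ^+ 2)%:E)%E.
  under [RHS]eq_integral do rewrite exprMn EFinM exprVn.
  rewrite [RHS]ge0_integralZl//; last 3 first.
  - apply/measurable_EFinP; apply: measurable_funX.
    apply: (@measurable_Rintegral_param _ _ _ _ _ mu
      (fun p : measurableTypeR R * measurableTypeR R => a p.2 * box_kernel (u n) p.1 p.2)).
    by apply: measurable_funM; [exact: (measurableT_comp ma)|exact: mbox].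
  - by move=> z _; rewrite lee_fin sqr_ge0.
  - by rewrite lee_fin ltW.
  rewrite -sinc_average// -ge0_integralZl//.
  - apply/measurable_EFinP; apply: measurable_funM => //.
    by apply: measurable_funX; exact: msinc.
  - by move=> y _; rewrite lee_fin mulr_ge0 ?sqr_ge0 ?P0.
  - by rewrite lee_fin ltW.
have mA n : measurable_fun setT (fun z =>
    (((u n)^-1 * \int[mu]_x (a x * box_kernel (u n) z x)) ^+ 2)%:E).
  apply/measurable_EFinP; apply: measurable_funX; apply: measurable_funM => //.
  apply: (@measurable_Rintegral_param _ _ _ _ _ mu
      (fun p : measurableTypeR R * measurableTypeR R => a p.2 * box_kernel (u n) p.1 p.2)).
  by apply: measurable_funM; [exact: (measurableT_comp ma)|exact: mbox].
have Sle n : (\int[mu]_y (S n y)%:E <= \int[mu]_x (a x ^+ 2)%:E)%E.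
  rewrite /S; under eq_integral do rewrite EFinM.
  rewrite ge0_integralZl//; last 3 first.
  - apply/measurable_EFinP; apply: measurable_funM => //.
    by apply: measurable_funX; exact: msinc.
  - by move=> y _; rewrite lee_fin mulr_ge0 ?sqr_ge0 ?P0.
  - by rewrite lee_fin ltW.
  rewrite sinc_average//.
  apply: (le_trans (lee_wpmul2l _ (average_le (u_gt0 n)))).
    by rewrite lee_fin ltW.
  by rewrite muleA -EFinM mulVf ?mul1e// gt_eqF// exprn_gt0.
apply/eqP; rewrite eq_le; apply/andP; split.
(* Upper bound for the transform: [S n] tends to [P] off 0, with integrals bounded through
   [average_le]. *)
- apply: (@fatou_le _ _ _ mu (fun n => EFin \o S n)) => //.
  + exact/measurable_EFinP.
  + exists [set 0]; split => //; first exact: lebesgue_measure_set1.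
    move=> y /= ny; apply: contrapT => /eqP y0; apply: ny.
    apply/cvg_EFin; first by near=> n.
    rewrite /comp/= -[X in _ --> X]mul1r /S.
    under eq_fun do rewrite mulrA.
    by apply: cvgMr_tmp; exact: sinc_kernel_cvg.
(* Lower bound: the squared averages tend a.e. to a^2, and their integrals equal those of [S n],
   which lies below [P]. *)
- apply: (@fatou_le _ _ _ mu (fun n z => (((u n)^-1 *
    \int[mu]_x (a x * box_kernel (u n) z x)) ^+ 2)%:E)) => //.
  + by move=> n z; rewrite lee_fin sqr_ge0.
  + by apply/measurable_EFinP; exact: measurable_funX.
  + by move=> x; rewrite lee_fin sqr_ge0.
  + have := average_cvg u_gt0 u0; apply: filterS; first exact: (ae_filter_ringOfSetsType mu).
    move=> z Hz; apply/cvg_EFin; first by near=> n.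
    by rewrite /comp/=; exact: cvg_sqr.
  + move=> n; rewrite -SE; apply: ge0_le_integral => //.
    * by move=> y _; rewrite lee_fin S0.
    * exact: mS.
    * by apply/measurable_EFinP.
    * move=> y _; rewrite lee_fin /S mulrA -[leRHS]mul1r ler_wpM2r//.
      by rewrite mulrC ler_pdivrMr ?exprn_gt0// mul1r sinc_kernel_le.
Unshelve. all: by end_near. Qed.

End RealPlancherel.

(** * Complex integrals and squared norms *)

Local Open Scope complex_scope.
Local Notation Re := complex.Re.
Local Notation Im := complex.Im.

Section SquaredModulus.
Context (R : realType).
Implicit Types (z w : R[i]).

Definition sqn z : R := Re z ^+ 2 + Im z ^+ 2.

Lemma sqn_ge0 z : 0 <= sqn z. Proof. by rewrite addr_ge0 ?sqr_ge0. Qed.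

Lemma normc_sqn z : Normc.normc z = Num.sqrt (sqn z). Proof. by case: z. Qed.

Lemma normc_ge0 z : 0 <= Normc.normc z.
Proof. by rewrite normc_sqn sqrtr_ge0. Qed.

Lemma sqr_normc z : Normc.normc z ^+ 2 = sqn z.
Proof. by rewrite normc_sqn sqr_sqrtr// sqn_ge0. Qed.

Lemma ReM z w : Re (z * w) = Re z * Re w - Im z * Im w.
Proof. by case: z; case: w. Qed.

Lemma ImM z w : Im (z * w) = Re z * Im w + Im z * Re w.
Proof. by case: z; case: w. Qed.

Lemma ReB z w : Re (z - w) = Re z - Re w.
Proof. by case: z; case: w. Qed.

Lemma ImB z w : Im (z - w) = Im z - Im w.
Proof. by case: z; case: w. Qed.

Lemma complex_eqP z w : Re z = Re w -> Im z = Im w -> z = w.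
Proof. by case: z => a b; case: w => c d /= -> ->. Qed.

Lemma sqnM z w : sqn (z * w) = sqn z * sqn w.
Proof. by rewrite /sqn ReM ImM; ring. Qed.

Lemma sqn_conjc z : sqn (conjc z) = sqn z.
Proof. by case: z => a b; rewrite /sqn /= sqrrN. Qed.

Lemma sqn_cexpi (t : R) : sqn (cexpi t) = 1.
Proof. exact: cos2Dsin2. Qed.

Lemma cexpiD (s t : R) : cexpi (s + t) = cexpi s * cexpi t.
Proof. by apply: complex_eqP; rewrite ?ReM ?ImM /= ?cosD ?sinD; ring. Qed.

Lemma normr_Re_le z : `|Re z| <= Normc.normc z.
Proof. by rewrite normc_sqn -sqrtr_sqr ler_wsqrtr// lerDl sqr_ge0. Qed.

Lemma normr_Im_le z : `|Im z| <= Normc.normc z.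
Proof. by rewrite normc_sqn -sqrtr_sqr ler_wsqrtr// lerDr sqr_ge0. Qed.

Lemma normc_le z : Normc.normc z <= `|Re z| + `|Im z|.
Proof.
rewrite -(ler_pXn2r (n := 2)) ?nnegrE ?normc_ge0 ?addr_ge0//.
rewrite sqr_normc /sqn -(real_normK (num_real (Re z))) -(real_normK (num_real (Im z))).
by have := mulr_ge0 (normr_ge0 (Re z)) (normr_ge0 (Im z)); nra.
Qed.

Lemma sqnB_le z w : sqn (z - w) <= 2 * sqn z + 2 * sqn w.
Proof.
rewrite /sqn ReB ImB.
by have := sqr_ge0 (Re z + Re w); have := sqr_ge0 (Im z + Im w); nra.
Qed.

End SquaredModulus.

Section ComplexMeasurable.
Context d (T : measurableType d) (R : realType).
Implicit Types (f g : T -> R[i]).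

Lemma cmeasurableM f g : cmeasurable_fun f -> cmeasurable_fun g ->
  cmeasurable_fun (fun x => f x * g x).
Proof.
move=> [fR fI] [gR gI]; split.
  by under eq_fun do rewrite ReM; apply: measurable_funB; exact: measurable_funM.
by under eq_fun do rewrite ImM; apply: measurable_funD; exact: measurable_funM.
Qed.

Lemma cmeasurableB f g : cmeasurable_fun f -> cmeasurable_fun g ->
  cmeasurable_fun (fun x => f x - g x).
Proof.
move=> [fR fI] [gR gI]; split.
  by under eq_fun do rewrite ReB; apply: measurable_funB.
by under eq_fun do rewrite ImB; apply: measurable_funB.
Qed.

Lemma cmeasurable_conjc f : cmeasurable_fun f -> cmeasurable_fun (fun x => conjc (f x)).
Proof.
move=> [fR fI]; split.
  by rewrite (_ : (fun x => _) = (fun x => Re (f x)))//; apply/funext => x; case: (f x).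
rewrite (_ : (fun x => _) = (fun x => - Im (f x))); first exact: measurableT_comp.
by apply/funext => x; case: (f x).
Qed.

Lemma cmeasurable_cst (c : R[i]) : cmeasurable_fun (fun _ : T => c).
Proof. by split; exact: measurable_cst. Qed.

Lemma cmeasurable_cexpi (u : T -> R) : measurable_fun setT u ->
  cmeasurable_fun (fun x => cexpi (u x)).
Proof.
move=> mu; split.
  exact: (measurableT_comp (continuous_measurable_fun (@continuous_cos R))).
exact: (measurableT_comp (continuous_measurable_fun (@continuous_sin R))).
Qed.

Lemma cmeasurable_comp d' (T' : measurableType d') (f : T -> R[i]) (phi : T' -> T) :
  cmeasurable_fun f -> measurable_fun setT phi -> cmeasurable_fun (fun x => f (phi x)).
Proof. by move=> [fR fI] mphi; split; [exact: (measurableT_comp fR mphi)|exact: (measurableT_comp fI mphi)]. Qed.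

Lemma measurable_sqn f : cmeasurable_fun f -> measurable_fun setT (fun x => sqn (f x)).
Proof. by move=> [fR fI]; apply: measurable_funD; exact: measurable_funX. Qed.

Lemma measurable_normc f : cmeasurable_fun f ->
  measurable_fun setT (fun x => Normc.normc (f x)).
Proof.
move=> mf; under eq_fun do rewrite normc_sqn.
apply: (@measurableT_comp _ _ _ _ _ _ (@Num.sqrt R)); last exact: measurable_sqn.
by apply: continuous_measurable_fun; exact: sqrt_continuous.
Qed.

End ComplexMeasurable.

Section ComplexIntegral.
Context d (T : measurableType d) (R : realType) (mu : {measure set T -> \bar R}).
Implicit Types (f g : T -> R[i]) (c : R[i]).

(** The squared L^2 norm, kept without its root so that Plancherel and Tonelli are plain equalities
    in [0, +oo]; [sqr_cLnorm2] relates it to [cLnorm]. *)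
Definition L2sq f : \bar R := (\int[mu]_x (sqn (f x))%:E)%E.

Definition cintegrable f :=
  mu.-integrable setT (fun x => (Re (f x))%:E) /\
  mu.-integrable setT (fun x => (Im (f x))%:E).

Lemma cintegrable_cmeasurable f : cintegrable f -> cmeasurable_fun f.
Proof.
by move=> [iR iI]; split; apply/measurable_EFinP; [exact: measurable_int iR|exact: measurable_int iI].
Qed.

Lemma L2sq_ge0 f : (0 <= L2sq f)%E.
Proof. by apply: integral_ge0 => x _; rewrite lee_fin sqn_ge0. Qed.

Lemma measurable_esqn f : cmeasurable_fun f -> measurable_fun setT (fun x => (sqn (f x))%:E).
Proof. by move=> mf; apply/measurable_EFinP; exact: measurable_sqn. Qed.

Lemma sqr_cLnorm2 f : cmeasurable_fun f -> (cLnorm mu 2 f * cLnorm mu 2 f = L2sq f)%E.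
Proof.
move=> mf; apply: etrans (sqr_Lnorm2 mu (measurable_normc mf)) _.
by apply: eq_integral => x _; rewrite sqr_normc.
Qed.

Lemma cLnorm2_lty f : cmeasurable_fun f -> (cLnorm mu 2 f < +oo)%E <-> (L2sq f < +oo)%E.
Proof.
move=> mf; rewrite -sqr_cLnorm2//.
have := Lnorm_ge0 mu 2 (fun x => (Normc.normc (f x))%:E).
rewrite -/(cLnorm mu 2 f); case: (cLnorm mu 2 f) => [r| |]// r0.
  by rewrite -EFinM !ltry.
Qed.

Lemma in_L2P f : in_Lp mu 2 f <-> cmeasurable_fun f /\ (L2sq f < +oo)%E.
Proof.
by split => -[mf foo]; split => //; apply/(cLnorm2_lty mf).
Qed.

Lemma cintegrableP f : cintegrable f <->
  cmeasurable_fun f /\ (\int[mu]_x (Normc.normc (f x))%:E < +oo)%E.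
Proof.
split=> [cf|[mf foo]].
  have mf := cintegrable_cmeasurable cf; have [mR mI] := mf; have [iR iI] := cf.
  split => //.
  have /integrableP[_ Roo] := iR; have /integrableP[_ Ioo] := iI.
  apply: (@le_lt_trans _ _ (\int[mu]_x (`|Re (f x)|%:E + `|Im (f x)|%:E))%E).
    apply: ge0_le_integral => //.
    - by move=> x _; rewrite lee_fin normc_ge0.
    - by apply/measurable_EFinP; exact: measurable_normc.
    - by apply: emeasurable_funD; apply/measurable_EFinP; exact: measurableT_comp.
    - by move=> x _; rewrite -EFinD lee_fin normc_le.
  rewrite ge0_integralD//; first exact: lte_add_pinfty.
    by apply/measurable_EFinP; exact: measurableT_comp.
  by apply/measurable_EFinP; exact: measurableT_comp.
have [mR mI] := mf.
have mn : measurable_fun setT (fun x => (Normc.normc (f x))%:E).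
  by apply/measurable_EFinP; exact: measurable_normc.
split; apply/integrableP; split; try exact/measurable_EFinP.
  apply: le_lt_trans foo; apply: ge0_le_integral => //.
  - by apply/measurable_EFinP; exact: measurableT_comp.
  - by move=> x _; rewrite lee_fin normr_Re_le.
apply: le_lt_trans foo; apply: ge0_le_integral => //.
- by apply/measurable_EFinP; exact: measurableT_comp.
- by move=> x _; rewrite lee_fin normr_Im_le.
Qed.

Lemma in_L1P f : in_Lp mu 1 f <-> cintegrable f.
Proof.
rewrite cintegrableP /in_Lp /cLnorm Lnorm1.
suff -> : (\int[mu]_x `|(Normc.normc (f x))%:E| = \int[mu]_x (Normc.normc (f x))%:E)%E by [].
by apply: eq_integral => x _; rewrite gee0_abs// lee_fin normc_ge0.
Qed.

Lemma cintegrable_le f g : cmeasurable_fun g -> cintegrable f ->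
  (forall x, sqn (g x) <= sqn (f x)) -> cintegrable g.
Proof.
move=> mg /cintegrableP[mf foo] gf; apply/cintegrableP; split => //.
apply: le_lt_trans foo; apply: ge0_le_integral => //.
- by move=> x _; rewrite lee_fin normc_ge0.
- by apply/measurable_EFinP; exact: measurable_normc.
- by apply/measurable_EFinP; exact: measurable_normc.
- by move=> x _; rewrite lee_fin !normc_sqn ler_wsqrtr.
Qed.

Lemma cintegrableM_unit f g : cintegrable f -> cmeasurable_fun g ->
  (forall x, sqn (g x) = 1) -> cintegrable (fun x => f x * g x).
Proof.
move=> cf mg g1; apply: (cintegrable_le _ cf).
  by apply: cmeasurableM => //; exact: cintegrable_cmeasurable.
by move=> x; rewrite sqnM g1 mulr1.
Qed.

Lemma cintegralMr f c : cintegrable f ->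
  cintegral mu (fun x => f x * c) = cintegral mu f * c.
Proof.
move=> [iR iI]; have ZR r : mu.-integrable setT (EFin \o (fun x => Re (f x) * r)).
  rewrite (_ : EFin \o _ = (fun x => r%:E * (Re (f x))%:E)%E); first exact: integrableZl.
  by apply/funext => x /=; rewrite mulrC EFinM.
have ZI r : mu.-integrable setT (EFin \o (fun x => Im (f x) * r)).
  rewrite (_ : EFin \o _ = (fun x => r%:E * (Im (f x))%:E)%E); first exact: integrableZl.
  by apply/funext => x /=; rewrite mulrC EFinM.
rewrite /cintegral; under eq_Rintegral do rewrite ReM.
under [in X in _ +i* X]eq_Rintegral do rewrite ImM.
rewrite RintegralB// RintegralD// !RintegralZr//.
by apply: complex_eqP; rewrite ?ReM ?ImM.
Qed.

Lemma cintegralB f g : cintegrable f -> cintegrable g ->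
  cintegral mu (fun x => f x - g x) = cintegral mu f - cintegral mu g.
Proof.
move=> [fR fI] [gR gI].
rewrite /cintegral; under eq_Rintegral do rewrite ReB.
under [in X in _ +i* X]eq_Rintegral do rewrite ImB.
by rewrite !RintegralB//; apply: complex_eqP; rewrite ?ReB ?ImB.
Qed.

Lemma cintegrableB f g : cintegrable f -> cintegrable g ->
  cintegrable (fun x => f x - g x).
Proof.
move=> [fR fI] [gR gI]; split.
  by under eq_fun do rewrite ReB; exact: (integrableB measurableT fR gR).
by under eq_fun do rewrite ImB; exact: (integrableB measurableT fI gI).
Qed.

Lemma eq_cintegral f g : f =1 g -> cintegral mu f = cintegral mu g.
Proof. by move=> fg; congr cintegral; apply/funext. Qed.

(* Rotating the integral onto the positive real axis leaves a real integral. *)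
Lemma normc_cintegral_le f : cintegrable f ->
  ((Normc.normc (cintegral mu f))%:E <= \int[mu]_x (Normc.normc (f x))%:E)%E.
Proof.
move=> cf; have /cintegrableP[mf foo] := cf.
set I := cintegral mu f; set r := Normc.normc I.
have mn : measurable_fun setT (fun x => (Normc.normc (f x))%:E).
  by apply/measurable_EFinP; exact: measurable_normc.
have [r0|r0] := eqVneq r 0.
  by rewrite r0; apply: integral_ge0 => x _; rewrite lee_fin normc_ge0.
have rgt0 : 0 < r by rewrite lt_neqAle eq_sym r0 normc_ge0.
pose c : R[i] := (Re I / r) -i* (Im I / r).
have sc : sqn c = 1.
  rewrite /sqn /= sqrrN !exprMn -mulrDl -/(sqn I) -sqr_normc -/r -exprMn divff//.
  by rewrite expr1n.
have cfc : cintegrable (fun x => f x * c).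
  by apply: cintegrableM_unit => //; exact: cmeasurable_cst.
have Ic : Re (cintegral mu (fun x => f x * c)) = r.
  rewrite cintegralMr// -/I ReM /= mulrN opprK.
  have -> : Re I * (Re I / r) + Im I * (Im I / r) = sqn I / r by rewrite /sqn; field.
  by rewrite -sqr_normc -/r expr2 mulfK.
rewrite -[X in X%:E]Ic /= /Rintegral fineK; last first.
  by apply: integrable_fin_num => //; exact: cfc.1.
apply: le_integral => //.
- exact: cfc.1.
- by apply/integrableP; split=> //; under eq_integral do rewrite gee0_abs ?lee_fin ?normc_ge0//.
- move=> x _; rewrite lee_fin (le_trans (ler_norm _))// (le_trans (normr_Re_le _))//.
  by rewrite !normc_sqn sqnM sc mulr1.
Qed.

Lemma sqn_cintegralM_le f g : cmeasurable_fun f -> cmeasurable_fun g ->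
  (L2sq f < +oo)%E -> (L2sq g < +oo)%E ->
  cintegrable (fun x => f x * g x) /\
  ((sqn (cintegral mu (fun x => (f x * g x)%R)))%:E <= L2sq f * L2sq g)%E.
Proof.
move=> mf mg foo goo.
have mnf := measurable_normc mf; have mng := measurable_normc mg.
have CS := cauchy_schwarz mu mnf mng.
have E h : (\int[mu]_x ((Normc.normc (h x)) ^+ 2)%:E = L2sq h)%E.
  by apply: eq_integral => x _; rewrite sqr_normc.
have NE : (\int[mu]_x `|Normc.normc (f x) * Normc.normc (g x)|%:E =
           \int[mu]_x (Normc.normc (f x * g x))%:E)%E.
  apply: eq_integral => x _; rewrite ger0_norm ?mulr_ge0 ?normc_ge0//.
  by rewrite !normc_sqn sqnM sqrtrM ?sqn_ge0.
rewrite NE !E in CS.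
set N := (\int[mu]_x (Normc.normc (f x * g x))%:E)%E in CS.
have N0 : (0 <= N)%E by apply: integral_ge0 => x _; rewrite lee_fin normc_ge0.
have LL : (L2sq f * L2sq g < +oo)%E.
  by apply: lte_mul_pinfty => //; rewrite ?L2sq_ge0// ge0_fin_numE ?L2sq_ge0.
(* Cauchy-Schwarz only bounds [N * N], and (+oo) * (+oo) = +oo rules out an infinite [N]. *)
have Noo : (N < +oo)%E.
  move: (le_lt_trans CS LL) N0; clearbody N; case: N {CS} => [r| |].
  - by move=> _ _; rewrite ltry.
  - by rewrite mulyy.
  - by [].
have cfg : cintegrable (fun x => f x * g x).
  by apply/cintegrableP; split => //; exact: cmeasurableM.
split => //; apply: le_trans CS.
rewrite -sqr_normc expr2 EFinM.
by apply: lee_pmul; rewrite ?lee_fin ?normc_ge0//; exact: normc_cintegral_le.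
Qed.

End ComplexIntegral.

(** * Parameter integrals and Fubini for complex functions *)

Section Param.
Context d1 d2 (X : measurableType d1) (Z : measurableType d2) (R : realType).
Variables (m : {sigma_finite_measure set X -> \bar R}).

Lemma cmeasurable_cintegral_param (F : Z * X -> R[i]) : cmeasurable_fun F ->
  cmeasurable_fun (fun z => cintegral m (fun x => F (z, x))).
Proof.
move=> [FR FI]; split.
  exact: (@measurable_Rintegral_param _ _ _ _ _ m (fun p => Re (F p)) FR).
exact: (@measurable_Rintegral_param _ _ _ _ _ m (fun p => Im (F p)) FI).
Qed.

End Param.

Section ComplexFubini.
Context d1 d2 (T1 : measurableType d1) (T2 : measurableType d2) (R : realType).
Variables (m1 : {sigma_finite_measure set T1 -> \bar R})
          (m2 : {sigma_finite_measure set T2 -> \bar R}).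

(** The inner extended integral is finite only for almost every y. On the exceptional set [fine] may
    change its value, so Fubini is carried over to real-valued integrals by a.e. equality. *)
Lemma integrable_Rintegral_fubini (f : T1 * T2 -> R) :
  (m1 \x m2)%E.-integrable setT (EFin \o f) ->
  m2.-integrable setT (fun y => (\int[m1]_x f (x, y))%:E) /\
  \int[m2]_y \int[m1]_x f (x, y) = \int[sf_prod m1 m2]_z f z.
Proof.
move=> iF; have iG := integrable_fubini_G iF.
have mG := measurable_int _ iG.
have mfG : measurable_fun setT (fun y => (\int[m1]_x f (x, y))%:E).
  by apply/measurable_EFinP; exact: (measurableT_comp _ mG).
split.
  apply: (le_integrable measurableT mfG _ iG) => y _.
  rewrite /Rintegral /fubini_G /=.
  by case: (\int[m1]_x (f (x, y))%:E)%E => [r| |] /=; rewrite ?normr0 ?leey.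
rewrite {1 3}/Rintegral; congr fine; rewrite -integral21_prod_meas1//.
apply: ae_eq_integral => //.
apply: filterS (integrable_ae measurableT iG) => y /(_ I) Gy _.
by rewrite /Rintegral fineK.
Qed.

Variable F : T1 * T2 -> R[i].
Hypothesis cF : cintegrable (sf_prod m1 m2) F.

Lemma cintegrable_fubini : cintegrable m2 (fun y => cintegral m1 (fun x => F (x, y))).
Proof.
by split; [have [] := integrable_Rintegral_fubini cF.1|
           have [] := integrable_Rintegral_fubini cF.2].
Qed.

Lemma cintegral_fubini :
  cintegral m2 (fun y => cintegral m1 (fun x => F (x, y))) = cintegral (sf_prod m1 m2) F.
Proof.
by apply: complex_eqP; [have [] := integrable_Rintegral_fubini cF.1|
           have [] := integrable_Rintegral_fubini cF.2].
Qed.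

Lemma ae_cintegrable : {ae m2, forall y, cintegrable m1 (fun x => F (x, y))}.
Proof.
have H1 := @ae_integrable2 _ _ _ _ _ m1 m2 _ cF.1.
have H2 := @ae_integrable2 _ _ _ _ _ m1 m2 _ cF.2.
by apply: filterS2 H1 H2 => y; split.
Qed.

End ComplexFubini.

Section L2sqProduct.
Context d1 d2 (T1 : measurableType d1) (T2 : measurableType d2) (R : realType).
Variables (m1 : {sigma_finite_measure set T1 -> \bar R})
          (m2 : {sigma_finite_measure set T2 -> \bar R}).
Variable F : T1 * T2 -> R[i].
Hypothesis mF : cmeasurable_fun F.

Let F0 p : (0 <= (sqn (F p))%:E)%E. Proof. by rewrite lee_fin sqn_ge0. Qed.

Lemma L2sq_prod1 :
  (L2sq (sf_prod m1 m2) F = \int[m1]_x \int[m2]_y (sqn (F (x, y)))%:E)%E.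
Proof.
exact: (@fubini_tonelli1 _ _ _ _ _ m1 m2 (fun p => (sqn (F p))%:E) (measurable_esqn mF) F0).
Qed.

Lemma L2sq_prod2 :
  (L2sq (sf_prod m1 m2) F = \int[m2]_y \int[m1]_x (sqn (F (x, y)))%:E)%E.
Proof.
exact: (@fubini_tonelli2 _ _ _ _ _ m1 m2 (fun p => (sqn (F p))%:E) (measurable_esqn mF) F0).
Qed.

Lemma measurable_L2sq_param2 : measurable_fun setT (fun y => L2sq m1 (fun x => F (x, y))).
Proof.
exact: (@measurable_fun_fubini_tonelli_G _ _ _ _ _ m1 (fun p => (sqn (F p))%:E)
  (measurable_esqn mF) F0).
Qed.

End L2sqProduct.

(** * Plancherel for general pairings *)

Section Plancherel.
Context (R : realType).

Definition ft d (T : measurableType d) (mu : {measure set T -> \bar R}) (e : T -> T -> R)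
  (f : T -> R[i]) (q : T) : R[i] :=
  cintegral mu (fun x => f x * cexpi (- (2 * pi * e q x))).

(** An equality in [0, +oo] over all of L^1. The pairing [e] is a parameter so that the property
    passes to products and images, and thus from the line to R^n and to the Heisenberg group. *)
Definition plancherel d (T : measurableType d) (mu : {measure set T -> \bar R})
    (e : T -> T -> R) : Prop :=
  measurable_fun setT (fun p => e p.1 p.2) /\
  forall f, cintegrable mu f -> L2sq mu (ft mu e f) = L2sq mu f.

Section Measurability.
Context d (T : measurableType d) (mu : {sigma_finite_measure set T -> \bar R}).
Variable e : T -> T -> R.
Hypothesis me : measurable_fun setT (fun p => e p.1 p.2).

Lemma measurable_pairing q : measurable_fun setT (e q).
Proof. exact: (measurableT_comp me (measurable_pair1 q)). Qed.

Lemma cmeasurable_character q : cmeasurable_fun (fun x => cexpi (- (2 * pi * e q x))).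
Proof.
apply: cmeasurable_cexpi; apply: measurableT_comp => //.
by apply: measurable_funM => //; exact: measurable_pairing.
Qed.

Lemma cintegrable_character f q : cintegrable mu f ->
  cintegrable mu (fun x => f x * cexpi (- (2 * pi * e q x))).
Proof.
move=> cf; apply: cintegrableM_unit => //; first exact: cmeasurable_character.
by move=> x; exact: sqn_cexpi.
Qed.

Lemma cmeasurable_ft f : cmeasurable_fun f -> cmeasurable_fun (ft mu e f).
Proof.
move=> mf; apply: (@cmeasurable_cintegral_param _ _ _ _ _ mu
  (fun p : T * T => f p.2 * cexpi (- (2 * pi * e p.1 p.2)))).
apply: cmeasurableM; first by apply: (cmeasurable_comp mf); exact: measurable_snd.
apply: cmeasurable_cexpi; apply: measurableT_comp => //.
exact: measurable_funM.
Qed.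

Lemma ftB f g : cintegrable mu f -> cintegrable mu g ->
  ft mu e (fun x => f x - g x) = (fun q => ft mu e f q - ft mu e g q).
Proof.
move=> cf cg; apply/funext => q; rewrite /ft -cintegralB; try exact: cintegrable_character.
by apply: eq_cintegral => x; rewrite mulrBl.
Qed.

End Measurability.

Lemma lebesgue_integralN (g : R -> \bar R) : measurable_fun setT g ->
  (forall x, (0 <= g x)%E) ->
  (\int[lebesgue_measure]_x g (- x)%R = \int[lebesgue_measure]_x g x)%E.
Proof.
move=> mg g0.
have mN : measurable_fun setT (-%R : measurableTypeR R -> measurableTypeR R).
  exact: (@measurable_funN _ _ _ _ id).
have := @ge0_integral_pushforward _ _ _ _ R _ mN lebesgue_measure setT g measurableT mg (fun y _ => g0 y).
rewrite preimage_setT => <-.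
by apply: eq_measure_integral => A mA _; exact: lebesgue_measureN.
Qed.

Lemma lebesgue_integral_even (g : R -> \bar R) : measurable_fun setT g ->
  (forall x, (0 <= g x)%E) ->
  (\int[lebesgue_measure]_x g x =
   (2^-1)%:E * \int[lebesgue_measure]_x (g x + g (- x)%R))%E.
Proof.
move=> mg g0.
have mgN : measurable_fun setT (fun q : R => g (- q)).
  by apply: (measurableT_comp mg); exact: (@measurable_funN _ _ _ _ id).
rewrite ge0_integralD// (lebesgue_integralN mg g0).
set X := (X in X = _); rewrite (_ : (X + X = 2%:E * X)%E); last by rewrite mule_natl mule2n.
by rewrite muleA -EFinM mulVf// mul1e.
Qed.

(* The cross terms between the real and imaginary parts of f are odd in q and
   cancel when q and -q are averaged. *)
Lemma plancherel_lebesgue :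
  plancherel (@lebesgue_measure R : {measure set (measurableTypeR R) -> \bar R}) (fun q x => (q : R) * (x : R)).
Proof.
split; first by apply: measurable_funM; [exact: measurable_fst|exact: measurable_snd].
move=> f [iR iI].
have ib (a b : R -> R) : (@lebesgue_measure R).-integrable setT (EFin \o a) ->
    continuous b -> (forall x, `|b x| <= 1) -> forall q,
    (@lebesgue_measure R).-integrable setT (EFin \o (fun x => a x * b (2 * pi * (q * x)))).
  move=> ia cb b1 q; have ma : measurable_fun setT a.
    by apply/measurable_EFinP; exact: measurable_int ia.
  apply: (le_integrable measurableT _ _ ia).
    apply/measurable_EFinP; apply: measurable_funM => //.
    apply: (measurableT_comp (continuous_measurable_fun cb)).
    by apply: measurable_funM => //; exact: measurable_funM.
  by move=> x _ /=; rewrite lee_fin normrM ler_piMr.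
have cc := @continuous_cos R; have cs := @continuous_sin R.
pose a x := Re (f x); pose b x := Im (f x).
have iac q : _ := ib a cos iR cc (@cos_max R) q; have ias q : _ := ib a sin iR cs (@sin_max R) q.
have ibc q : _ := ib b cos iI cc (@cos_max R) q; have ibs q : _ := ib b sin iI cs (@sin_max R) q.
pose A q := cos_transform a q; pose B q := sin_transform a q.
pose C q := cos_transform b q; pose D q := sin_transform b q.
have fE q : ft lebesgue_measure (fun q x => q * x) f q = (A q + D q) +i* (C q - B q).
  rewrite /ft /cintegral /A /B /C /D /cos_transform /sin_transform.
  rewrite -RintegralD// -RintegralB//.
  by congr (_ +i* _); apply: eq_Rintegral => x _; rewrite ?ReM ?ImM /= cosN sinN /a /b; ring.
have mA : measurable_fun setT A by exact: measurable_cos_transform.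
have mB : measurable_fun setT B by exact: measurable_sin_transform.
have mC : measurable_fun setT C by exact: measurable_cos_transform.
have mD : measurable_fun setT D by exact: measurable_sin_transform.
have AN q : A (- q) = A q.
  by apply: eq_Rintegral => x _; rewrite mulNr mulrN cosN.
have CN q : C (- q) = C q.
  by apply: eq_Rintegral => x _; rewrite mulNr mulrN cosN.
have BN q : B (- q) = - B q.
  rewrite /B /sin_transform -[RHS]mulN1r -RintegralZl//.
  by apply: eq_Rintegral => x _; rewrite mulNr [2 * pi * - _]mulrN sinN; ring.
have DN q : D (- q) = - D q.
  rewrite /D /sin_transform -[RHS]mulN1r -RintegralZl//.
  by apply: eq_Rintegral => x _; rewrite mulNr [2 * pi * - _]mulrN sinN; ring.
pose S q := (A q + D q) ^+ 2 + (C q - B q) ^+ 2.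
have mS : measurable_fun setT (EFin \o S).
  apply/measurable_EFinP; apply: measurable_funD; apply: measurable_funX.
    exact: measurable_funD.
  exact: measurable_funB.
have S0 q : (0 <= (EFin \o S) q)%E by rewrite lee_fin addr_ge0 ?sqr_ge0.
have LE : L2sq lebesgue_measure (ft lebesgue_measure (fun q x => q * x) f) =
    (\int[lebesgue_measure]_q (S q)%:E)%E.
  by apply: eq_integral => q _; rewrite fE.
rewrite LE.
have PE : (\int[lebesgue_measure]_q (A q ^+ 2 + B q ^+ 2)%:E +
          \int[lebesgue_measure]_q (C q ^+ 2 + D q ^+ 2)%:E = L2sq lebesgue_measure f)%E.
  rewrite (plancherel_real iR) (plancherel_real iI) -ge0_integralD//.
  - by move=> x _; rewrite lee_fin sqr_ge0.
  - by apply/measurable_EFinP; apply: measurable_funX; apply/measurable_EFinP; exact: measurable_int iR.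
  - by move=> x _; rewrite lee_fin sqr_ge0.
  - by apply/measurable_EFinP; apply: measurable_funX; apply/measurable_EFinP; exact: measurable_int iI.
have mAB : measurable_fun setT (fun q => (A q ^+ 2 + B q ^+ 2)%:E).
  by apply/measurable_EFinP; apply: measurable_funD; exact: measurable_funX.
have mCD : measurable_fun setT (fun q => (C q ^+ 2 + D q ^+ 2)%:E).
  by apply/measurable_EFinP; apply: measurable_funD; exact: measurable_funX.
have SP : (\int[lebesgue_measure]_q (A q ^+ 2 + B q ^+ 2)%:E +
          \int[lebesgue_measure]_q (C q ^+ 2 + D q ^+ 2)%:E =
    \int[lebesgue_measure]_q ((A q ^+ 2 + B q ^+ 2)%:E + (C q ^+ 2 + D q ^+ 2)%:E))%E.
  rewrite [RHS]ge0_integralD//.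
  - by move=> q _; rewrite lee_fin addr_ge0 ?sqr_ge0.
  - by move=> q _; rewrite lee_fin addr_ge0 ?sqr_ge0.
apply: etrans PE; rewrite SP (lebesgue_integral_even mS S0) -ge0_integralZl//.
- apply: eq_integral => q _ /=; rewrite /S AN BN CN DN -!EFinD -EFinM; congr EFin.
  by field.
- apply: emeasurable_funD => //.
  by apply: (measurableT_comp mS); exact: (@measurable_funN _ _ _ _ id).
- by move=> q _; rewrite adde_ge0.
Qed.

Section Product.
Context d1 d2 (T1 : measurableType d1) (T2 : measurableType d2).
Variables (m1 : {sigma_finite_measure set T1 -> \bar R})
          (m2 : {sigma_finite_measure set T2 -> \bar R}).
Variables (e1 : T1 -> T1 -> R) (e2 : T2 -> T2 -> R).

(** One variable at a time through the partial transform [psi]: [P2] applies to psi(xi, .) for every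
    xi, Tonelli swaps the integrals, and [P1] applies to the slice f(., y) for almost every y. *)
Lemma plancherel_prod : plancherel m1 e1 -> plancherel m2 e2 ->
  plancherel (sf_prod m1 m2) (fun q x => e1 q.1 x.1 + e2 q.2 x.2).
Proof.
move=> [me1 P1] [me2 P2].
have me : measurable_fun setT (fun p : (T1 * T2) * (T1 * T2) =>
    e1 p.1.1 p.2.1 + e2 p.1.2 p.2.2).
  apply: measurable_funD.
    apply: (measurable_comp_pair me1);
      by apply: measurableT_comp; [exact: measurable_fst|first [exact: measurable_fst|exact: measurable_snd]].
  apply: (measurable_comp_pair me2);
    by apply: measurableT_comp; [exact: measurable_snd|first [exact: measurable_fst|exact: measurable_snd]].
split => // f cf; have mf := cintegrable_cmeasurable cf.
pose e (q x : T1 * T2) := e1 q.1 x.1 + e2 q.2 x.2.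
change (measurable_fun setT (fun p : (T1 * T2) * (T1 * T2) => e p.1 p.2)) in me.
change (L2sq (sf_prod m1 m2) (ft (sf_prod m1 m2) e f) = L2sq (sf_prod m1 m2) f).
(* Only the first phase is inserted: Fubini for this integrable function makes psi(xi, .) integrable
   for every xi. *)
pose F xi (p : T1 * T2) := f p * cexpi (- (2 * pi * e1 xi p.1)).
have cF xi : cintegrable (sf_prod m1 m2) (F xi).
  apply: cintegrableM_unit => //; last by move=> p; exact: sqn_cexpi.
  apply: (cmeasurable_comp (cmeasurable_character me1 xi)); exact: measurable_fst.
pose psi (p : T1 * T2) := ft m1 e1 (fun x => f (x, p.2)) p.1.
have mpsi : cmeasurable_fun psi.
  apply: (@cmeasurable_cintegral_param _ _ _ _ _ m1 (fun q : (T1 * T2) * T1 =>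
    f (q.2, q.1.2) * cexpi (- (2 * pi * e1 q.1.1 q.2)))).
  have m12 : measurable_fun setT (fun q : (T1 * T2) * T1 => q.1.2).
    by apply: measurableT_comp; [exact: measurable_snd|exact: measurable_fst].
  have m11 : measurable_fun setT (fun q : (T1 * T2) * T1 => q.1.1).
    by apply: measurableT_comp; [exact: measurable_fst|exact: measurable_fst].
  have m2' : measurable_fun setT (fun q : (T1 * T2) * T1 => q.2) by exact: measurable_snd.
  apply: cmeasurableM.
    by split; [exact: (measurable_comp_pair mf.1)|exact: (measurable_comp_pair mf.2)].
  apply: cmeasurable_cexpi; apply: measurableT_comp => //.
  by apply: measurable_funM => //; exact: (measurable_comp_pair me1).
have cpsi xi : cintegrable m2 (fun y => psi (xi, y)).
  exact: (cintegrable_fubini (cF xi)).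
have aef := ae_cintegrable cf.
have ftE xi eta : ft (sf_prod m1 m2) e f (xi, eta) = ft m2 e2 (fun y => psi (xi, y)) eta.
  have cG := cintegrable_character me (xi, eta) cf.
  rewrite {1}/ft -(cintegral_fubini cG) /ft.
  have mG := cintegrable_cmeasurable (cintegrable_fubini cG).
  have mH := cintegrable_cmeasurable (cintegrable_character me2 eta (cpsi xi)).
  (* Pulling the phase in y out of the x-integral requires an integrable slice, hence the
     restriction to almost every y. *)
  have E : {ae m2, forall y,
     cintegral m1 (fun x => f (x, y) * cexpi (- (2 * pi * e (xi, eta) (x, y)))) =
     psi (xi, y) * cexpi (- (2 * pi * e2 eta y))}.
    apply: filterS aef => y cfy.
    rewrite /psi /ft -cintegralMr; last exact: cintegrable_character.
    by apply: eq_cintegral => x; rewrite -[RHS]mulrA -cexpiD /e /=; congr (_ * cexpi _); ring.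
  apply: complex_eqP; rewrite /Rintegral; congr fine; apply: ae_eq_integral => //.
  - by apply/measurable_EFinP; exact: mG.1.
  - by apply/measurable_EFinP; exact: mH.1.
  - by apply: filterS E => y -> _.
  - by apply/measurable_EFinP; exact: mG.2.
  - by apply/measurable_EFinP; exact: mH.2.
  - by apply: filterS E => y -> _.
have mft := cmeasurable_ft (sf_prod m1 m2) me mf.
rewrite (L2sq_prod1 m1 m2 mft).
transitivity (\int[m1]_xi \int[m2]_y (sqn (psi (xi, y)))%:E)%E.
  apply: eq_integral => xi _; rewrite -[RHS](P2 _ (cpsi xi)).
  by apply: eq_integral => eta _; rewrite ftE.
transitivity (L2sq (sf_prod m1 m2) psi); first by rewrite (L2sq_prod1 m1 m2 mpsi).
rewrite (L2sq_prod2 m1 m2 mpsi) (L2sq_prod2 m1 m2 mf).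
apply: ae_eq_integral => //.
- exact: (measurable_L2sq_param2 m1 mpsi).
- exact: (measurable_L2sq_param2 m1 mf).
- by apply: filterS aef => y cfy _; have E := P1 (fun x => f (x, y)) cfy; exact: E.
Qed.

End Product.

Section Pushforward.
Context d1 d2 (T1 : measurableType d1) (T2 : measurableType d2).
Variables (m1 : {measure set T1 -> \bar R}) (m2 : {measure set T2 -> \bar R}).
Variable phi : T1 -> T2.
Hypothesis mphi : measurable_fun setT phi.
Hypothesis m2E : forall A, measurable A -> m2 A = m1 (phi @^-1` A).

Lemma ge0_integral_image (g : T2 -> \bar R) : measurable_fun setT g ->
  (forall x, (0 <= g x)%E) -> (\int[m2]_x g x = \int[m1]_x g (phi x))%E.
Proof.
move=> mg g0.
have := @ge0_integral_pushforward _ _ _ _ R _ mphi m1 setT g measurableT mg (fun y _ => g0 y).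
rewrite preimage_setT => <-.
by apply: eq_measure_integral => A mA _; exact: m2E.
Qed.

Lemma Rintegral_image (g : T2 -> R) : measurable_fun setT g ->
  \int[m2]_x g x = \int[m1]_x g (phi x).
Proof.
move=> mg; have mEg : measurable_fun setT (EFin \o g) by exact/measurable_EFinP.
rewrite /Rintegral integralE [in RHS]integralE; congr (fine (_ - _)%E).
  by apply: etrans (ge0_integral_image (measurable_funepos mEg) _) _ => //;
    apply: eq_integral => x _; rewrite !funeposE.
by apply: etrans (ge0_integral_image (measurable_funeneg mEg) _) _ => //;
    apply: eq_integral => x _; rewrite !funenegE.
Qed.

Lemma cintegral_image (f : T2 -> R[i]) : cmeasurable_fun f ->
  cintegral m2 f = cintegral m1 (fun x => f (phi x)).
Proof. by move=> [mR mI]; rewrite /cintegral (Rintegral_image mR) (Rintegral_image mI). Qed.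

Lemma L2sq_image (f : T2 -> R[i]) : cmeasurable_fun f ->
  L2sq m2 f = L2sq m1 (fun x => f (phi x)).
Proof.
move=> mf; apply: ge0_integral_image; first exact: measurable_esqn.
by move=> x; rewrite lee_fin sqn_ge0.
Qed.

Lemma cintegrable_image (f : T2 -> R[i]) : cintegrable m2 f ->
  cintegrable m1 (fun x => f (phi x)).
Proof.
move=> /cintegrableP[mf foo]; apply/cintegrableP; split.
  exact: cmeasurable_comp.
rewrite -(@ge0_integral_image (fun x => (Normc.normc (f x))%:E))//.
  by apply/measurable_EFinP; exact: measurable_normc.
by move=> x; rewrite lee_fin normc_ge0.
Qed.

End Pushforward.

Lemma plancherel_image d1 d2 (T1 : measurableType d1) (T2 : measurableType d2)
    (m1 : {measure set T1 -> \bar R}) (m2 : {sigma_finite_measure set T2 -> \bar R})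
    (e1 : T1 -> T1 -> R) (e2 : T2 -> T2 -> R) (phi : T1 -> T2) :
  measurable_fun setT phi ->
  (forall A, measurable A -> m2 A = m1 (phi @^-1` A)) ->
  measurable_fun setT (fun p => e2 p.1 p.2) ->
  (forall q x, e2 (phi q) (phi x) = e1 q x) ->
  plancherel m1 e1 -> plancherel m2 e2.
Proof.
move=> mphi m2E me2 e21 [me1 P1]; split => // f cf.
have mf := cintegrable_cmeasurable cf.
rewrite (L2sq_image mphi m2E mf) (L2sq_image mphi m2E (cmeasurable_ft m2 me2 mf)).
rewrite -(P1 _ (cintegrable_image mphi m2E cf)); congr L2sq.
apply/funext => q; rewrite /ft (cintegral_image mphi m2E).
  by apply: eq_cintegral => x; rewrite e21.
exact: (cintegrable_cmeasurable (cintegrable_character me2 _ cf)).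
Qed.

End Plancherel.

(** * Lebesgue measure on tuples and on the Heisenberg group *)

Section Tuples.
Context (R : realType).
Local Notation RT := (measurableTypeR R).

(** The translated measure gives half-open intervals their length, and this characterizes Lebesgue
    measure. *)
Lemma lebesgue_measureD (a : R) (A : set R) : measurable A ->
  lebesgue_measure A = lebesgue_measure ((fun x : RT => (x : R) + a) @^-1` A).
Proof.
move=> mA.
have mD : measurable_fun setT (fun x : RT => (x : R) + a : RT).
  exact: measurable_funD.
have -> : lebesgue_measure ((fun x : RT => (x : R) + a) @^-1` A) =
  pushforward lebesgue_measure (fun x : RT => (x : R) + a : RT) A by [].
pose P : {measure set RT -> \bar R} :=
  measure_function_pushforward__canonical__measure_function_Measure lebesgue_measure mD.
apply: (@lebesgue_measure_unique R P) => //= _ [[c d]] _ <-.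
rewrite /pushforward.
have -> : (fun x : RT => (x : R) + a) @^-1` `]c, d]%classic = `](c - a), (d - a)]%classic.
  by apply/seteqP; split => x /=; rewrite !in_itv/= ltrBlDr lerBrDr.
rewrite !lebesgue_measure_itv/= !lte_fin ltrD2r.
by case: ifP => // _; rewrite -!EFinD; congr EFin; ring.
Qed.

Lemma lebesgue_integralD (g : RT -> \bar R) (a : R) : measurable_fun setT g ->
  (forall x, (0 <= g x)%E) ->
  (\int[lebesgue_measure]_x g ((x : R) + a)%R = \int[lebesgue_measure]_x g x)%E.
Proof.
move=> mg g0; apply/esym.
apply: (@ge0_integral_image R _ _ _ _ lebesgue_measure lebesgue_measure (fun x : RT => (x : R) + a : RT)) => //.
  exact: measurable_funD.
by move=> A mA; exact: lebesgue_measureD.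
Qed.

Lemma measurable_dotp n : measurable_fun setT
  (fun p : n.-tuple RT * n.-tuple RT => dotp p.1 p.2).
Proof.
apply: measurable_sum => i; apply: measurable_funM.
  by apply: (measurableT_comp (@measurable_tnth _ RT n i)); exact: measurable_fst.
by apply: (measurableT_comp (@measurable_tnth _ RT n i)); exact: measurable_snd.
Qed.

Lemma measurable_addp n : measurable_fun setT
  (fun p : n.-tuple RT * n.-tuple RT => addp p.1 p.2).
Proof.
apply/measurable_fun_tnthP => i.
rewrite (_ : _ \o _ = (fun p : n.-tuple RT * n.-tuple RT => (tnth p.1 i : R) + tnth p.2 i)).
  apply: measurable_funD.
    by apply: (measurableT_comp (@measurable_tnth _ RT n i)); exact: measurable_fst.
  by apply: (measurableT_comp (@measurable_tnth _ RT n i)); exact: measurable_snd.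
by apply/funext => p /=; rewrite /addp tnth_mktuple.
Qed.

Lemma addpC n (p q : n.-tuple RT) : addp p q = addp q p.
Proof. by apply: eq_from_tnth => i; rewrite !tnth_mktuple addrC. Qed.

Lemma tnth_tcons0 n (x : RT * n.-tuple RT) : tnth (tcons x) ord0 = x.1.
Proof. by []. Qed.

Lemma tnth_tconsS n (x : RT * n.-tuple RT) i : tnth (tcons x) (lift ord0 i) = tnth x.2 i.
Proof. by rewrite tnthS. Qed.

Lemma dotp_tcons n (x y : RT * n.-tuple RT) :
  dotp (tcons x) (tcons y) = (x.1 : R) * y.1 + dotp x.2 y.2.
Proof.
rewrite /dotp big_ord_recl !tnth_tcons0; congr (_ + _).
by apply: eq_bigr => i _; rewrite !tnth_tconsS.
Qed.

Lemma addp_tcons n (x y : RT * n.-tuple RT) :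
  addp (tcons x) (tcons y) = tcons ((x.1 : R) + y.1 : RT, addp x.2 y.2).
Proof.
apply: eq_from_tnth => i; rewrite tnth_mktuple.
have [->|[j ->]] : i = ord0 \/ exists j, i = lift ord0 j.
  by case: (unliftP ord0 i) => [j ->|->]; [right; exists j|left].
  by rewrite !tnth_tcons0.
by rewrite !tnth_tconsS/= tnth_mktuple.
Qed.

Lemma tcons_surj n (a : n.+1.-tuple RT) : exists x : RT * n.-tuple RT, a = tcons x.
Proof. by case: (tupleP a) => x t; exists (x, t); exact: val_inj. Qed.

Lemma plancherel_leb n : plancherel (leb R n) (@dotp R n).
Proof.
elim: n => [|n IH].
  (* Base case: [leb R 0] is the unit mass at the empty tuple and the pairing vanishes there, so the
     transform is the identity. *)
  split; first exact: measurable_dotp.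
  move=> f cf; have mf := cintegrable_cmeasurable cf.
  have D (g : 0.-tuple RT -> \bar R) : measurable_fun setT g ->
      (\int[leb R 0]_x g x = g [tuple])%E.
    by move=> mg; rewrite integral_dirac// diracT mul1e.
  rewrite /L2sq !D; last 2 first.
    exact: measurable_esqn.
    by apply: measurable_esqn; apply: cmeasurable_ft => //; exact: measurable_dotp.
  have mc := cintegrable_cmeasurable (cintegrable_character (@measurable_dotp 0) [tuple] cf).
  congr (sqn _)%:E; rewrite /ft /cintegral /Rintegral !D; last 2 first.
    by apply/measurable_EFinP; exact: mc.2.
    by apply/measurable_EFinP; exact: mc.1.
  rewrite /dotp big_ord0 mulr0 oppr0 /cexpi cos0 sin0 /=.
  by case: (f [tuple]) => a b /=; congr (_ +i* _)%C; ring.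
apply: (@plancherel_image R _ _ _ _ (sf_prod lebesgue_measure (leb R n)) (leb R n.+1)
  (fun q x => (q.1 : R) * x.1 + dotp q.2 x.2) (@dotp R n.+1) (@tcons RT n)).
- exact: measurable_tcons.
- by [].
- exact: measurable_dotp.
- by move=> q x; rewrite dotp_tcons.
- exact: (plancherel_prod (plancherel_lebesgue R) IH).
Qed.

Lemma leb_tcons_integral n (g : n.+1.-tuple RT -> \bar R) : measurable_fun setT g ->
  (forall x, (0 <= g x)%E) ->
  (\int[leb R n.+1]_x g x =
   \int[lebesgue_measure]_x \int[leb R n]_y g (tcons (x, y)))%E.
Proof.
move=> mg g0.
have -> : (\int[leb R n.+1]_x g x =
    \int[sf_prod lebesgue_measure (leb R n)]_x g (tcons x))%E.
  apply: (@ge0_integral_image R _ _ _ _ (sf_prod lebesgue_measure (leb R n)) (leb R n.+1) (@tcons RT n)) => //.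
  exact: measurable_tcons.
apply: (@fubini_tonelli1 _ _ _ _ _ lebesgue_measure (leb R n) (g \o (@tcons RT n))) => //.
  by apply: (measurableT_comp mg); exact: measurable_tcons.
by move=> x; exact: g0.
Qed.

Lemma measurable_addpl n (a : n.-tuple RT) : measurable_fun setT (fun x => addp x a).
Proof. exact: (measurableT_comp (@measurable_addp n) (measurable_pair2 a)). Qed.

Lemma leb_integralD n (g : n.-tuple RT -> \bar R) a : measurable_fun setT g ->
  (forall x, (0 <= g x)%E) ->
  (\int[leb R n]_x g (addp x a) = \int[leb R n]_x g x)%E.
Proof.
elim: n g a => [|n IH] g a mg g0.
  by apply: eq_integral => x _; rewrite (tuple0 (addp x a)) (tuple0 x).
have mga : measurable_fun setT (fun x => g (addp x a)).
  by apply: (measurableT_comp mg); exact: measurable_addpl.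
rewrite (leb_tcons_integral mga (fun x => g0 _)) (leb_tcons_integral mg g0).
have [[a0 a'] ->] := tcons_surj a.
have mgc : measurable_fun setT (fun p : RT * n.-tuple RT => g (tcons p)).
  by apply: (measurableT_comp mg); exact: measurable_tcons.
pose h (x : RT) : \bar R := (\int[leb R n]_y g (tcons (x, y)))%E.
transitivity (\int[lebesgue_measure]_x h ((x : R) + a0)%R)%E.
  apply: eq_integral => x _.
  under eq_integral do rewrite addp_tcons/=.
  rewrite (IH (fun y => g (tcons ((x : R) + a0 : RT, y))))//.
  exact: (measurableT_comp mgc (measurable_pair1 _)).
apply: lebesgue_integralD.
  exact: (@measurable_fun_fubini_tonelli_F _ _ _ _ _ (leb R n) (fun p => g (tcons p))).
by move=> x; exact: integral_ge0.
Qed.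

End Tuples.

Section HeisenbergTranslations.
Context (R : realType) (n : nat).
Local Notation RT := (measurableTypeR R).
Local Notation tup := (n.-tuple RT).
Implicit Types (X P : heis R n) (F : heis R n -> \bar R).

Lemma plancherel_heis : plancherel (leb_heis R n) (@heis_dot R n).
Proof.
exact: (plancherel_prod (plancherel_prod (plancherel_leb R n) (plancherel_leb R n))
  (plancherel_lebesgue R)).
Qed.

(** The common shape of left and right Heisenberg translations: a shift in p and q together with a
    shear [c] in t. Integrating t first, at fixed (p, q), turns the shear into a plain
    translation. *)
Lemma heis_shift_integral F (a b : tup) (c : tup * tup -> R) :
  measurable_fun setT F -> (forall X, (0 <= F X)%E) -> measurable_fun setT c ->
  (\int[leb_heis R n]_X F (addp X.1.1 a, addp X.1.2 b, ((X.2 : R) + c X.1)%R : RT) =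
   \int[leb_heis R n]_X F X)%E.
Proof.
move=> mF F0 mc.
pose phi X : heis R n := (addp X.1.1 a, addp X.1.2 b, (X.2 : R) + c X.1 : RT).
have m1 : measurable_fun setT (fun X : heis R n => X.1) by exact: measurable_fst.
have m11 : measurable_fun setT (fun X : heis R n => X.1.1).
  exact: (measurableT_comp measurable_fst m1).
have m12 : measurable_fun setT (fun X : heis R n => X.1.2).
  exact: (measurableT_comp measurable_snd m1).
have mphi : measurable_fun setT phi.
  apply/measurable_fun_pairP; split.
    apply/measurable_fun_pairP; split.
      exact: (measurableT_comp (measurable_addpl a) m11).
    exact: (measurableT_comp (measurable_addpl b) m12).
  apply: measurable_funD; first exact: measurable_snd.
  exact: (measurableT_comp mc m1).
have mFphi : measurable_fun setT (F \o phi) by exact: measurableT_comp.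
have T1 G : measurable_fun setT G -> (forall X, (0 <= G X)%E) ->
    (\int[leb_heis R n]_X G X =
     \int[sf_prod (leb R n) (leb R n)]_p \int[lebesgue_measure]_t G (p, t))%E.
  by move=> mG G0; exact: (@fubini_tonelli1 _ _ _ _ _ (sf_prod (leb R n) (leb R n)) lebesgue_measure G).
apply: etrans (T1 (F \o phi) mFphi (fun X => F0 _)) _.
apply: etrans (esym (T1 F mF F0)).
pose G (p : tup * tup) : \bar R := (\int[lebesgue_measure]_t F (p, t))%E.
have mG : measurable_fun setT G.
  exact: (@measurable_fun_fubini_tonelli_F _ _ _ _ _ lebesgue_measure F).
have G0 p : (0 <= G p)%E by exact: integral_ge0.
transitivity (\int[sf_prod (leb R n) (leb R n)]_p G (addp p.1 a, addp p.2 b))%E.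
  apply: eq_integral => p _ /=.
  apply: (@lebesgue_integralD R (fun t => F (addp p.1 a, addp p.2 b, t)) (c p)) => //.
  exact: (measurableT_comp mF (measurable_pair1 _)).
have mGp : measurable_fun setT (fun p => G (addp p.1 a, addp p.2 b)).
  apply: (measurable_comp_pair mG).
    exact: (measurableT_comp (measurable_addpl a) measurable_fst).
  exact: (measurableT_comp (measurable_addpl b) measurable_snd).
have T2 H : measurable_fun setT H -> (forall p, (0 <= H p)%E) ->
    (\int[sf_prod (leb R n) (leb R n)]_p H p = \int[leb R n]_x \int[leb R n]_y H (x, y))%E.
  by move=> mH H0; exact: (@fubini_tonelli1 _ _ _ _ _ (leb R n) (leb R n) H).
apply: etrans (T2 _ mGp (fun p => G0 _)) _.
apply: etrans (esym (T2 _ mG G0)).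
pose K (x : tup) : \bar R := (\int[leb R n]_y G (x, y))%E.
transitivity (\int[leb R n]_x K (addp x a))%E.
  apply: eq_integral => x _ /=.
  apply: (@leb_integralD R n (fun y => G (addp x a, y)) b) => //.
  exact: (measurableT_comp mG (measurable_pair1 _)).
apply: leb_integralD.
  exact: (@measurable_fun_fubini_tonelli_F _ _ _ _ _ (leb R n) G).
by move=> x; exact: integral_ge0.
Qed.

Lemma heis_integral_mulr F P : measurable_fun setT F -> (forall X, (0 <= F X)%E) ->
  (\int[leb_heis R n]_X F (heis_mul X P) = \int[leb_heis R n]_X F X)%E.
Proof.
move=> mF F0.
pose c (p : tup * tup) : R := (P.2 : R) + 2^-1 * (dotp p.1 P.1.2 - dotp p.2 P.1.1).
have mc : measurable_fun setT c.
  apply: measurable_funD => //; apply: measurable_funM => //; apply: measurable_funB.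
    exact: (measurable_comp_pair (@measurable_dotp R n) measurable_fst).
  exact: (measurable_comp_pair (@measurable_dotp R n) measurable_snd).
rewrite -(heis_shift_integral P.1.1 P.1.2 mF F0 mc).
by apply: eq_integral => X _; rewrite /heis_mul /c addrA.
Qed.

Lemma heis_integral_mull F X : measurable_fun setT F -> (forall X, (0 <= F X)%E) ->
  (\int[leb_heis R n]_P F (heis_mul X P) = \int[leb_heis R n]_P F P)%E.
Proof.
move=> mF F0.
pose c (p : tup * tup) : R := (X.2 : R) + 2^-1 * (dotp X.1.1 p.2 - dotp X.1.2 p.1).
have mc : measurable_fun setT c.
  apply: measurable_funD => //; apply: measurable_funM => //; apply: measurable_funB.
    exact: (measurable_comp_pair (@measurable_dotp R n) (measurable_cst _) measurable_snd).
  exact: (measurable_comp_pair (@measurable_dotp R n) (measurable_cst _) measurable_fst).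
rewrite -(heis_shift_integral X.1.1 X.1.2 mF F0 mc).
apply: eq_integral => P _; rewrite /heis_mul /c addrA (addpC X.1.1) (addpC X.1.2).
by rewrite [(X.2 : R) + P.2]addrC.
Qed.

Lemma measurable_heis_mul :
  measurable_fun setT (fun p : heis R n * heis R n => heis_mul p.1 p.2).
Proof.
have f1 : measurable_fun setT (fun p : heis R n * heis R n => p.1.1).
  exact: (measurableT_comp measurable_fst measurable_fst).
have f2 : measurable_fun setT (fun p : heis R n * heis R n => p.2.1).
  exact: (measurableT_comp measurable_fst measurable_snd).
have f11 : measurable_fun setT (fun p : heis R n * heis R n => p.1.1.1).
  exact: (measurableT_comp measurable_fst f1).
have f12 : measurable_fun setT (fun p : heis R n * heis R n => p.1.1.2).
  exact: (measurableT_comp measurable_snd f1).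
have f21 : measurable_fun setT (fun p : heis R n * heis R n => p.2.1.1).
  exact: (measurableT_comp measurable_fst f2).
have f22 : measurable_fun setT (fun p : heis R n * heis R n => p.2.1.2).
  exact: (measurableT_comp measurable_snd f2).
have t1 : measurable_fun setT (fun p : heis R n * heis R n => p.1.2).
  exact: (measurableT_comp measurable_snd measurable_fst).
have t2 : measurable_fun setT (fun p : heis R n * heis R n => p.2.2).
  exact: (measurableT_comp measurable_snd measurable_snd).
apply/measurable_fun_pairP; split.
  apply/measurable_fun_pairP; split.
    exact: (measurable_comp_pair (@measurable_addp R n) f11 f21).
  exact: (measurable_comp_pair (@measurable_addp R n) f12 f22).
apply: measurable_funD; first exact: measurable_funD.
apply: measurable_funM => //; apply: measurable_funB.
  exact: (measurable_comp_pair (@measurable_dotp R n) f11 f22).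
exact: (measurable_comp_pair (@measurable_dotp R n) f12 f21).
Qed.

End HeisenbergTranslations.

(** * Extension of the Fourier transform to L^2 *)

Section L2Limits.
Context d (T : measurableType d) (R : realType) (mu : {measure set T -> \bar R}).
Implicit Types (f g h : T -> R[i]).
Local Notation Re := complex.Re.
Local Notation Im := complex.Im.

(** The triangle inequality for squared norms, at the price of a factor 2, from |z - w|^2 <= 2 |z|^2
    + 2 |w|^2. *)
Lemma L2sqB_le f g : cmeasurable_fun f -> cmeasurable_fun g ->
  (L2sq mu (fun x => (f x - g x)%R) <= 2%:E * L2sq mu f + 2%:E * L2sq mu g)%E.
Proof.
move=> mf mg; have ef := measurable_esqn mf; have eg := measurable_esqn mg.
have f0 x : (0 <= (sqn (f x))%:E)%E by rewrite lee_fin sqn_ge0.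
have g0 x : (0 <= (sqn (g x))%:E)%E by rewrite lee_fin sqn_ge0.
rewrite /L2sq -!ge0_integralZl// -ge0_integralD//.
- apply: ge0_le_integral => //.
  + by move=> x _; rewrite lee_fin sqn_ge0.
  + by apply: measurable_esqn; exact: cmeasurableB.
  + by apply: emeasurable_funD; exact: measurable_funeM.
  + by move=> x _; rewrite -!EFinM -EFinD lee_fin sqnB_le.
- by move=> x _; rewrite mule_ge0.
- exact: measurable_funeM.
- by move=> x _; rewrite mule_ge0.
- exact: measurable_funeM.
Qed.

Lemma sqre_le (x : \bar R) (r : R) : (0 <= x)%E -> 0 <= r ->
  (x * x <= (r ^+ 2)%:E)%E -> (x <= r%:E)%E.
Proof.
move=> x0 r0; case: x x0 => [s| |]//.
  by rewrite !lee_fin => s0; rewrite -expr2 ler_pXn2r ?nnegrE.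
Qed.

Lemma cLnorm2_cvg0 (F : nat -> T -> R[i]) (r : nat -> R) :
  (forall k, cmeasurable_fun (F k)) -> (forall k, 0 <= r k) ->
  r k @[k --> \oo] --> 0 -> (forall k, (L2sq mu (F k) <= (r k ^+ 2)%:E)%E) ->
  cLnorm mu 2 (F k) @[k --> \oo] --> 0%E.
Proof.
move=> mF r0 cr Fr.
apply: (@squeeze_cvge _ _ _ _ (cst 0%E) _ (EFin \o r)).
- near=> k; rewrite Lnorm_ge0/=; apply: sqre_le => //; first exact: Lnorm_ge0.
  by rewrite sqr_cLnorm2.
- exact: cvg_cst.
- by apply/cvg_EFin => //; near=> k.
Unshelve. all: by end_near. Qed.

(** Small values are cut off: where |h|^2 > 1 / (k + 1) one has |h| <= (k + 1) |h|^2, so the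
    truncation is integrable; the remainder tends to 0 in L^2 by domination by |h|^2. *)
Lemma L2_truncate h (eps : R) : cmeasurable_fun h -> (L2sq mu h < +oo)%E -> 0 < eps ->
  exists v, [/\ cintegrable mu v, (L2sq mu v < +oo)%E &
    (L2sq mu (fun x => (v x - h x)%R) <= eps%:E)%E].
Proof.
move=> mh hoo eps0.
have ms := measurable_sqn mh; have es := measurable_esqn mh.
have s0 x := sqn_ge0 (h x).
have mb k : measurable_fun setT (fun x => k.+1%:R^-1 < sqn (h x)).
  by apply: measurable_fun_ltr.
pose v k x : R[i] := if k.+1%:R^-1 < sqn (h x) then h x else 0.
have mv k : cmeasurable_fun (v k).
  have [mR mI] := mh; split.
    rewrite (_ : (fun x => _) = (fun x => if k.+1%:R^-1 < sqn (h x) then Re (h x) else 0)).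
      exact: measurable_fun_ifT.
    by apply/funext => x; rewrite /v; case: ifP.
  rewrite (_ : (fun x => _) = (fun x => if k.+1%:R^-1 < sqn (h x) then Im (h x) else 0)).
    exact: measurable_fun_ifT.
  by apply/funext => x; rewrite /v; case: ifP.
have sqn0 : sqn (0 : R[i]) = 0 by rewrite /sqn /= expr0n addr0.
have cv k : cintegrable mu (v k).
  apply/cintegrableP; split => //.
  apply: (@le_lt_trans _ _ (k.+1%:R%:E * L2sq mu h)%E); last first.
    by apply: lte_mul_pinfty => //; rewrite ?lee_fin.
  have es0 x : setT x -> (0 <= (sqn (h x))%:E)%E by rewrite lee_fin.
  rewrite /L2sq -ge0_integralZl ?lee_fin//; apply: ge0_le_integral => //.
  - by move=> x _; rewrite lee_fin normc_ge0.
  - by apply/measurable_EFinP; exact: measurable_normc.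
  - exact: measurable_funeM.
  - move=> x _; rewrite -EFinM lee_fin /v; case: ifPn => [sh|_]; last first.
      by rewrite normc_sqn sqn0 sqrtr0 mulr_ge0.
    have K1 : 1 <= k.+1%:R :> R by rewrite ler1n.
    have Ks : 1 < k.+1%:R * sqn (h x) by rewrite mulrC -ltr_pdivrMr// div1r.
    rewrite normc_sqn -(ler_pXn2r (n := 2)) ?nnegrE ?sqrtr_ge0 ?mulr_ge0//.
    by rewrite sqr_sqrtr//; have := s0 x; nra.
have vh k x : sqn (v k x - h x) = if k.+1%:R^-1 < sqn (h x) then 0 else sqn (h x).
  rewrite /v; case: ifP => _; first by rewrite subrr.
  by rewrite sub0r; case: (h x) => a b; rewrite /sqn /= !sqrrN.
have cvg0 : (\int[mu]_x (sqn (v k x - h x))%:E @[k --> \oo] --> \int[mu]_x (cst 0%E) x)%E.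
  apply: (@dominated_cvg _ _ _ mu setT measurableT _ _ (fun x => (sqn (h x))%:E)) => //.
  - by move=> k; apply: measurable_esqn; exact: cmeasurableB.
  - move=> x _; have [hx0|hx0] := eqVneq (sqn (h x)) 0.
      rewrite (_ : (fun k => _) = cst 0%E); first exact: cvg_cst.
      by apply/funext => k; rewrite vh hx0; case: ifP.
    have hgt : 0 < sqn (h x) by rewrite lt_neqAle eq_sym hx0 s0.
    apply: (@cvg_near_cst); near=> k; rewrite /= vh.
    suff -> : k.+1%:R^-1 < sqn (h x) by [].
    near: k; have := @cvg_harmonic R; rewrite /harmonic => /cvgr_lt; exact.
  - apply/integrableP; split => //.
    suff -> : (\int[mu]_x `|(sqn (h x))%:E| = L2sq mu h)%E by [].
    by apply: eq_integral => x _; rewrite gee0_abs ?lee_fin.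
  - move=> k x _; rewrite gee0_abs ?lee_fin ?sqn_ge0// vh.
    by case: ifP.
rewrite integral0 in cvg0.
move/fine_cvgP : cvg0 => -[fin0 /cvgr_lt/(_ _ eps0) lt0].
near \oo => k.
exists (v k); split => //.
  apply: le_lt_trans hoo; apply: ge0_le_integral => //.
  - by move=> x _; rewrite lee_fin sqn_ge0.
  - exact: measurable_esqn.
  - by move=> x _; rewrite lee_fin /v; case: ifP; rewrite ?sqn0.
rewrite /L2sq -[X in (X <= _)%E]fineK; last by near: k.
by rewrite lee_fin ltW//; near: k.
Unshelve. all: by end_near. Qed.

Lemma cvg_geometric_increments (r : nat -> R) (C : R) : 0 <= C ->
  (forall k, `|r k.+1 - r k| <= C * (2^-1) ^+ k) -> cvgn r.
Proof.
move=> C0 rC.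
have -> : r = (fun n => r 0%N + series (telescope r) n).
  by apply/funext => n; exact: eq_sum_telescope.
apply: is_cvgD; first exact: is_cvg_cst.
apply: normed_cvg.
apply: (@series_le_cvg _ _ (geometric C 2^-1)) => //.
- by move=> k; exact: normr_ge0.
- by move=> k /=; rewrite mulr_ge0 ?exprn_ge0.
- by apply: is_cvg_geometric_series; rewrite ger0_norm ?invr_ge0//; lra.
Qed.

(* The rate 8^-k in square norm makes the sum of 4^k |W_k - W_(k+1)|^2 a.e.
   finite, so W converges a.e. geometrically and Fatou gives the L^2 bound. H is
   a limsup to be measurable everywhere. *)
Lemma L2_complete (W : nat -> T -> R[i]) :
  (forall k, cmeasurable_fun (W k)) -> (L2sq mu (W 0%N) < +oo)%E ->
  (forall k m, (k <= m)%N ->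
    (L2sq mu (fun x => (W k x - W m x)%R) <= (4 * (8^-1) ^+ k)%:E)%E) ->
  exists H, [/\ cmeasurable_fun H, (L2sq mu H < +oo)%E &
    forall k, (L2sq mu (fun x => (W k x - H x)%R) <= (4 * (8^-1) ^+ k)%:E)%E].
Proof.
move=> mW W0 WC.
pose D k x := sqn (W k x - W k.+1 x).
have D0 k x : 0 <= D k x by exact: sqn_ge0.
have mD k : measurable_fun setT (D k).
  by apply: measurable_sqn; exact: cmeasurableB.
pose E k x := (4 ^+ k * D k x)%:E.
have E0 k x : (0 <= E k x)%E by rewrite lee_fin mulr_ge0 ?exprn_ge0.
have mE k : measurable_fun setT (E k).
  by apply/measurable_EFinP; exact: measurable_funM.
pose S x := (\sum_(0 <= k <oo) E k x)%E.
have mS : measurable_fun setT S by apply: ge0_emeasurable_sum => // k x _ _; exact: E0.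
(* The bound is 4^k * 4 * 8^-k, written in the form of the geometric series summed below. *)
have intE k : (\int[mu]_x E k x <= (8 / (2 ^ (k + 1))%:R)%:E)%E.
  rewrite /E; under eq_integral do rewrite EFinM.
  rewrite ge0_integralZl//; last 2 first.
    exact/measurable_EFinP.
    by move=> x _; rewrite lee_fin D0.
  apply: (le_trans (lee_wpmul2l _ (WC k k.+1 (leqnSn k)))).
    by rewrite lee_fin exprn_ge0.
  rewrite -EFinM lee_fin natrX exprD expr1 le_eqVlt; apply/orP; left; apply/eqP.
  rewrite mulrCA -exprMn (_ : 4 * 8^-1 = 2^-1); last by field.
  rewrite exprVn; field.
  by rewrite expf_neq0.
have intS : (\int[mu]_x S x < +oo)%E.
  rewrite integral_nneseries//.
  apply: (@le_lt_trans _ _ (\sum_(0 <= k <oo) (8 / (2 ^ (k + 1))%:R)%:E)%E).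
    by apply: lee_nneseries => // k _ _; exact: integral_ge0.
  have := @cvg_geometric_eseries_half R 8 0%N; move/cvg_lim => -> //.
  exact: ltry.
have aeS : {ae mu, forall x, S x \is a fin_num}.
  have iS : mu.-integrable setT S.
    apply/integrableP; split => //.
    under eq_integral do rewrite gee0_abs ?nneseries_ge0//.
    exact: intS.
  by apply: filterS (integrable_ae measurableT iS) => x; apply.
have Dle x k : S x \is a fin_num -> sqn (W k.+1 x - W k x) <= fine (S x) * (4^-1) ^+ k.
  move=> Sfin; have : (E k x <= S x)%E.
    apply: (@le_trans _ _ (\sum_(0 <= j < k.+1) E j x)%E).
      by rewrite big_nat_recr//= leeDr// sume_ge0.
    exact: nneseries_lim_ge.
  rewrite -{1}(fineK Sfin) lee_fin exprVn ler_pdivlMr ?exprn_gt0// mulrC.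
  apply: le_trans; rewrite le_eqVlt; apply/orP; left; apply/eqP; congr (_ * _).
  by rewrite /D /sqn !(ReB, ImB); ring.
have sqrt4 k : Num.sqrt ((4^-1) ^+ k) = (2^-1) ^+ k :> R.
  rewrite (_ : 4^-1 = (2^-1) ^+ 2 :> R); last by field.
  by rewrite exprAC sqrtr_sqr ger0_norm ?exprn_ge0.
have cvgRI x : S x \is a fin_num ->
    cvgn (fun n => Re (W n x)) /\ cvgn (fun n => Im (W n x)).
  move=> Sfin; have fS0 : 0 <= fine (S x) by rewrite fine_ge0// nneseries_ge0.
  have N k : Normc.normc (W k.+1 x - W k x) <= Num.sqrt (fine (S x)) * (2^-1) ^+ k.
    by rewrite normc_sqn -sqrt4 -sqrtrM// ler_wsqrtr// Dle.
  split; apply: (@cvg_geometric_increments _ (Num.sqrt (fine (S x)))).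
  - exact: sqrtr_ge0.
  - by move=> k; rewrite -ReB (le_trans (normr_Re_le _)).
  - exact: sqrtr_ge0.
  - by move=> k; rewrite -ImB (le_trans (normr_Im_le _)).
pose LS (p : R[i] -> R) x := fine (limn_esup (fun n => (p (W n x))%:E)).
pose H x : R[i] := (LS (@complex.Re R) x +i* LS (@complex.Im R) x)%C.
have mLS (p : R[i] -> R) : (forall k, measurable_fun setT (fun x => p (W k x))) ->
    measurable_fun setT (LS p).
  move=> mp; apply: measurableT_comp => //.
  apply: (@measurable_fun_limn_esup _ _ _ setT (fun k x => (p (W k x))%:E)) => k.
  exact/measurable_EFinP.
have mH : cmeasurable_fun H.
  split.
    by apply: (mLS (@complex.Re R)) => k; exact: (mW k).1.
  by apply: (mLS (@complex.Im R)) => k; exact: (mW k).2.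
have LSE (p : R[i] -> R) x : cvgn (fun n => p (W n x)) ->
    p (W n x) @[n --> \oo] --> LS p x.
  move=> cp; have cE : (p (W n x))%:E @[n --> \oo] --> (limn (fun n => p (W n x)))%:E.
    by apply/cvg_EFin => //; near=> n.
  by rewrite /LS (cvg_limn_einf_sup cE).2.
have WH k : (L2sq mu (fun x => (W k x - H x)%R) <= (4 * (8^-1) ^+ k)%:E)%E.
  apply: (@fatou_le _ _ _ mu (fun m x => (sqn (W k x - W (k + m)%N x))%:E)).
  - by move=> m; apply: measurable_esqn; exact: cmeasurableB.
  - by move=> m x; rewrite lee_fin sqn_ge0.
  - by apply: measurable_esqn; exact: cmeasurableB.
  - by move=> x; rewrite lee_fin sqn_ge0.
  - apply: filterS aeS => x /cvgRI[cR cI].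
    have sh (p : R[i] -> R) : cvgn (fun n => p (W n x)) ->
        p (W (k + m)%N x) @[m --> \oo] --> LS p x.
      move=> /LSE; rewrite -(cvg_shiftn k).
      by under eq_fun do rewrite addnC.
    apply/cvg_EFin; first by near=> m.
    rewrite /comp/= /sqn.
    rewrite (_ : (fun m => _) = (fun m => (Re (W k x) - Re (W (k + m)%N x)) ^+ 2 +
       (Im (W k x) - Im (W (k + m)%N x)) ^+ 2)); last first.
      by apply/funext => m; rewrite ReB ImB.
    rewrite ReB ImB /=; apply: cvgD; apply: cvg_sqr; apply: cvgB;
      by [exact: cvg_cst|exact: sh].
  - by move=> m; apply: WC; exact: leq_addr.
exists H; split => //.
have -> : H = (fun x => W 0%N x - (W 0%N x - H x)) by apply/funext => x; rewrite subKr.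
have mWH : cmeasurable_fun (fun x => W 0%N x - H x) by exact: cmeasurableB.
apply: (le_lt_trans (L2sqB_le (mW 0%N) mWH)).
apply: lte_add_pinfty; apply: lte_mul_pinfty => //.
by apply: (le_lt_trans (WH 0%N)); exact: ltry.
Unshelve. all: by end_near. Qed.

End L2Limits.

Section FourierL2.
Context d (T : measurableType d) (R : realType) (mu : {sigma_finite_measure set T -> \bar R}).
Variable e : T -> T -> R.
Hypothesis P : plancherel mu e.
Implicit Types (f g h : T -> R[i]).

Let me : measurable_fun setT (fun p => e p.1 p.2) := P.1.

Let L2sq_ftB f g : cintegrable mu f -> cintegrable mu g ->
  L2sq mu (fun x => ft mu e f x - ft mu e g x) = L2sq mu (fun x => f x - g x).
Proof.
by move=> cf cg; rewrite -(P.2 _ (cintegrableB cf cg)) (ftB me cf cg).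
Qed.

(** Choosing u_k within 8^-k of h in squared norm gives |u_k - u_m|^2 <= 2 * 8^-k + 2 * 8^-m <= 4 *
    8^-k for k <= m. Plancherel on differences passes this to the transforms, in the form required
    by [L2_complete]. *)
Lemma plancherel_extension_exists h : in_Lp mu 2 h ->
  exists H, in_Lp mu 2 H /\ exists u : nat -> T -> R[i],
    [/\ forall k, in_Lp mu 1 (u k) /\ in_Lp mu 2 (u k),
        cLnorm mu 2 (fun X => u k X - h X) @[k --> \oo] --> 0%E &
        cLnorm mu 2 (fun X => ft mu e (u k) X - H X) @[k --> \oo] --> 0%E].
Proof.
move=> /in_L2P[mh hoo].
have e0 k : 0 < (8^-1) ^+ k :> R by rewrite exprn_gt0.
have [u uP] : exists u : nat -> T -> R[i], forall k,
    [/\ cintegrable mu (u k), (L2sq mu (u k) < +oo)%E &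
    (L2sq mu (fun x => (u k x - h x)%R) <= ((8^-1) ^+ k)%:E)%E].
  have /choice[u uP] : forall k : nat, exists v, [/\ cintegrable mu v, (L2sq mu v < +oo)%E &
    (L2sq mu (fun x => (v x - h x)%R) <= ((8^-1) ^+ k)%:E)%E].
    by move=> k; exact: L2_truncate.
  by exists u.
have cu k : cintegrable mu (u k) by have [] := uP k.
have mu_ k : cmeasurable_fun (u k) := cintegrable_cmeasurable (cu k).
pose W k := ft mu e (u k).
have mW k : cmeasurable_fun (W k) by exact: cmeasurable_ft.
have W0 : (L2sq mu (W 0%N) < +oo)%E by rewrite P.2//; have [] := uP 0%N.
have WC k m : (k <= m)%N ->
    (L2sq mu (fun x => (W k x - W m x)%R) <= (4 * (8^-1) ^+ k)%:E)%E.
  move=> km; rewrite L2sq_ftB//.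
  have -> : (fun x => u k x - u m x) = (fun x => (u k x - h x) - (u m x - h x)).
    by apply/funext => x; rewrite opprB addrA subrK.
  have mk j : cmeasurable_fun (fun x => u j x - h x) by exact: cmeasurableB.
  apply: (le_trans (L2sqB_le mu (mk k) (mk m))).
  have [_ _ uk] := uP k; have [_ _ um] := uP m.
  apply: (@le_trans _ _ (2%:E * ((8^-1) ^+ k)%:E + 2%:E * ((8^-1) ^+ k)%:E)%E).
    apply: leeD; apply: lee_wpmul2l; rewrite ?lee_fin//.
    by apply: (le_trans um); rewrite lee_fin; apply: ler_wiXn2l => //; lra.
  by rewrite -!EFinM -EFinD lee_fin; lra.
have [H [mH Hoo WH]] := L2_complete mW W0 WC.
(* The square of this rate is 4 * 4^-k, which dominates both 8^-k and 4 * 8^-k. *)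
have r0 : 2 * (2^-1) ^+ k @[k --> \oo] --> (0 : R).
  by apply: cvg_geometric; rewrite ger0_norm ?invr_ge0//; lra.
have r8 k : (8^-1) ^+ k <= ((2^-1) ^+ k) ^+ 2 :> R.
  rewrite exprAC; apply: lerXn2r; rewrite ?nnegrE ?exprn_ge0//; lra.
have rge0 k : 0 <= 2 * (2^-1) ^+ k :> R by rewrite mulr_ge0 ?exprn_ge0.
exists H; split; first by apply/in_L2P.
exists u; split.
- by move=> k; split; [exact/in_L1P|apply/in_L2P; split => //; have [] := uP k].
- apply: (cLnorm2_cvg0 _ rge0 r0); first by move=> k; exact: cmeasurableB.
  move=> k; have [_ _ uk] := uP k; apply: (le_trans uk); rewrite lee_fin exprMn.
  by apply: (le_trans (r8 k)); have := sqr_ge0 ((2^-1) ^+ k : R); lra.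
- apply: (cLnorm2_cvg0 _ rge0 r0); first by move=> k; exact: (cmeasurableB (mW k) mH).
  move=> k; apply: (le_trans (WH k)); rewrite lee_fin exprMn.
  by have := r8 k; lra.
Qed.

(** |h|^2 is controlled by |u_k|^2 and |u_k - h|^2. Plancherel replaces |u_k| by the norm of its
    transform, which is controlled by the distance to H when H has norm 0; everything tends to 0. *)
Lemma plancherel_extension_neq0 h H (u : nat -> T -> R[i]) :
  in_Lp mu 2 h -> in_Lp mu 2 H ->
  (forall k, in_Lp mu 1 (u k) /\ in_Lp mu 2 (u k)) ->
  cLnorm mu 2 (fun X => u k X - h X) @[k --> \oo] --> 0%E ->
  cLnorm mu 2 (fun X => ft mu e (u k) X - H X) @[k --> \oo] --> 0%E ->
  L2sq mu H = 0%E -> h = cst 0 %[ae mu].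
Proof.
move=> /in_L2P[mh hoo] /in_L2P[mH Hoo] uL uh uH H0.
have cu k : cintegrable mu (u k) by apply/in_L1P; have [] := uL k.
have mu_ k : cmeasurable_fun (u k) := cintegrable_cmeasurable (cu k).
have mW k : cmeasurable_fun (ft mu e (u k)) by exact: cmeasurable_ft.
have m1 k : cmeasurable_fun (fun x => u k x - h x) by exact: cmeasurableB.
have m2 k : cmeasurable_fun (fun x => ft mu e (u k) x - H x) by exact: cmeasurableB.
have hle k : (L2sq mu h <=
    2%:E * (2%:E * (cLnorm mu 2 (fun X => ft mu e (u k) X - H X)%R *
      cLnorm mu 2 (fun X => ft mu e (u k) X - H X)%R)) +
    2%:E * (cLnorm mu 2 (fun X => u k X - h X)%R * cLnorm mu 2 (fun X => u k X - h X)%R))%E.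
  rewrite !sqr_cLnorm2//.
  have {1}-> : h = (fun x => u k x - (u k x - h x)) by apply/funext => x; rewrite subKr.
  apply: (le_trans (L2sqB_le mu (mu_ k) (m1 k))); apply: leeD => //.
  apply: lee_wpmul2l => //; rewrite -P.2//.
  have {1}-> : ft mu e (u k) = (fun x => (ft mu e (u k) x - H x) - (0 - H x)).
    by apply/funext => x; rewrite sub0r opprK subrK.
  have mN : cmeasurable_fun (fun x => 0 - H x).
    by apply: cmeasurableB => //; exact: cmeasurable_cst.
  apply: (le_trans (L2sqB_le mu (m2 k) mN)).
  suff -> : L2sq mu (fun x => 0 - H x) = 0%E by rewrite mule0 adde0.
  rewrite -H0; apply: eq_integral => x _; congr EFin.
  by rewrite sub0r; case: (H x) => a b; rewrite /sqn /= !sqrrN.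
have L0 : L2sq mu h = 0%E.
  apply/eqP; rewrite eq_le L2sq_ge0 andbT.
  have cv : (2%:E * (2%:E * (cLnorm mu 2 (fun X => ft mu e (u k) X - H X)%R *
      cLnorm mu 2 (fun X => ft mu e (u k) X - H X)%R)) +
    2%:E * (cLnorm mu 2 (fun X => u k X - h X)%R * cLnorm mu 2 (fun X => u k X - h X)%R))%E
     @[k --> \oo] --> (2%:E * (2%:E * (0 * 0)) + 2%:E * (0 * 0))%E.
    apply: cvgeD; first by rewrite !mule0.
      by apply: cvgeZl => //; apply: cvgeZl => //; apply: cvgeM => //; rewrite mule_def_fin.
    by apply: cvgeZl => //; apply: cvgeM => //; rewrite mule_def_fin.
  rewrite !mule0 adde0 in cv.
  by apply: (cvge_ge _ cv); exact: nearW.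
have es := measurable_esqn mh.
have /(ae_eq_integral_abs mu measurableT es) : (\int[mu]_x `|(sqn (h x))%:E| = 0)%E.
  by rewrite -[RHS]L0; apply: eq_integral => x _; rewrite gee0_abs ?lee_fin ?sqn_ge0.
apply: filterS => x /(_ I) [] /= s0 _.
have := s0; rewrite /sqn => /eqP; rewrite paddr_eq0 ?sqr_ge0// !sqrf_eq0 => /andP[/eqP r0 /eqP i0].
exact: complex_eqP.
Qed.

End FourierL2.

(** * The short-time Fourier transform and concentration *)

Section ShortTimeFourier.
Context d (T : measurableType d) (R : realType) (mu : {sigma_finite_measure set T -> \bar R}).
Variables (e : T -> T -> R) (mul : T -> T -> T).
Hypotheses (P : plancherel mu e) (mmul : measurable_fun setT (fun p : T * T => mul p.1 p.2)).
Hypothesis L2sq_mulr : forall h y, cmeasurable_fun h ->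
  L2sq mu (fun x => h (mul x y)) = L2sq mu h.
Hypothesis L2sq_mull : forall h x, cmeasurable_fun h ->
  L2sq mu (fun y => h (mul x y)) = L2sq mu h.
Variables F G : T -> R[i].
Hypotheses (mF : cmeasurable_fun F) (mG : cmeasurable_fun G).
Hypotheses (Foo : (L2sq mu F < +oo)%E) (Goo : (L2sq mu G < +oo)%E).

Definition windowed y x := F x * conjc (G (mul x y)).

Definition short_time_ft (z : T * T) := ft mu e (windowed z.2) z.1.

Lemma measurable_mulr y : measurable_fun setT (fun x => mul x y).
Proof. exact: (measurable_comp_pair mmul (@measurable_id _ _ setT) (@measurable_cst _ _ _ _ setT y)). Qed.

Let mGr y : cmeasurable_fun (fun x => conjc (G (mul x y))).
Proof. by apply: cmeasurable_conjc; exact: (cmeasurable_comp mG (measurable_mulr y)). Qed.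

Let L2Gr y : L2sq mu (fun x => conjc (G (mul x y))) = L2sq mu G.
Proof.
rewrite -(L2sq_mulr y mG); apply: eq_integral => x _; by rewrite sqn_conjc.
Qed.

(** Right invariance keeps the translated window in L^2, so Cauchy-Schwarz applies for every y; this
    integrability is what lets [plancherel] act at each fixed y. *)
Lemma cintegrable_windowed y : cintegrable mu (windowed y).
Proof.
have Gy : (L2sq mu (fun x => conjc (G (mul x y))) < +oo)%E by rewrite L2Gr.
exact: (sqn_cintegralM_le mF (mGr y) Foo Gy).1.
Qed.

Lemma short_time_ft_le z : ((sqn (short_time_ft z))%:E <= L2sq mu F * L2sq mu G)%E.
Proof.
(* The phase has modulus 1, so attaching it to the window leaves the norm unchanged. *)
pose c x := conjc (G (mul x z.2)) * cexpi (- (2 * pi * e z.1 x)).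
have mc : cmeasurable_fun c.
  by apply: cmeasurableM => //; exact: (cmeasurable_character P.1).
have Lc : L2sq mu c = L2sq mu G.
  rewrite -(L2Gr z.2); apply: eq_integral => x _; by rewrite /c sqnM sqn_cexpi mulr1.
have coo : (L2sq mu c < +oo)%E by rewrite Lc.
have -> : short_time_ft z = cintegral mu (fun x => F x * c x).
  rewrite /short_time_ft /ft; congr cintegral.
  by apply/funext => x; rewrite /windowed mulrA.
by have := (sqn_cintegralM_le mF mc Foo coo).2; rewrite Lc.
Qed.

Let cmeasurable_windowed d' (Z : measurableType d') (u v : Z -> T) :
  measurable_fun setT u -> measurable_fun setT v ->
  cmeasurable_fun (fun z => windowed (u z) (v z)).
Proof.
move=> mu_ mv; apply: cmeasurableM; first exact: (cmeasurable_comp mF mv).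
apply: cmeasurable_conjc; apply: (cmeasurable_comp mG).
exact: (measurable_comp_pair mmul mv mu_).
Qed.

Lemma cmeasurable_short_time_ft : cmeasurable_fun short_time_ft.
Proof.
apply: (cmeasurable_cintegral_param mu
  (F := fun p : T * T * T => windowed p.1.2 p.2 * cexpi (- (2 * pi * e p.1.1 p.2)))).
have m11 : measurable_fun setT (fun p : T * T * T => p.1.1).
  exact: (measurableT_comp measurable_fst measurable_fst).
have m12 : measurable_fun setT (fun p : T * T * T => p.1.2).
  exact: (measurableT_comp measurable_snd measurable_fst).
have m2 : measurable_fun setT (fun p : T * T * T => p.2) by exact: measurable_snd.
apply: cmeasurableM; first exact: cmeasurable_windowed.
apply: cmeasurable_cexpi; apply: measurableT_comp => //.
apply: measurable_funM => //.
exact: (measurable_comp_pair P.1 m11 m2).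
Qed.

Lemma L2sq_short_time_ft :
  L2sq (sf_prod mu mu) short_time_ft = (L2sq mu F * L2sq mu G)%E.
Proof.
apply: etrans (L2sq_prod2 mu mu cmeasurable_short_time_ft) _.
transitivity (\int[mu]_y \int[mu]_x (sqn (windowed y x))%:E)%E.
  (* Plancherel at each y, where both sides may be +oo. *)
  by apply: eq_integral => y _; exact: (P.2 _ (cintegrable_windowed y)).
have m1 : measurable_fun setT (fst : T * T -> T) by exact: measurable_fst.
have m2 : measurable_fun setT (snd : T * T -> T) by exact: measurable_snd.
have mw : measurable_fun setT (fun p : T * T => (sqn (windowed p.2 p.1))%:E).
  by apply: measurable_esqn; exact: cmeasurable_windowed.
have w0 (p : T * T) : (0 <= (sqn (windowed p.2 p.1))%:E)%E by rewrite lee_fin sqn_ge0.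
apply: etrans (esym (fubini_tonelli _ mw w0)) _ => /=.
(* After Tonelli x is fixed and the window is integrated over its right factor, hence left
   invariance. *)
transitivity (\int[mu]_x ((sqn (F x))%:E * L2sq mu G))%E.
  apply: eq_integral => x _.
  rewrite -(L2sq_mull x mG) /L2sq -ge0_integralZl//.
  - by apply: eq_integral => y _; rewrite -EFinM /windowed sqnM sqn_conjc.
  - apply: measurable_esqn; apply: (cmeasurable_comp mG).
    exact: (measurable_comp_pair mmul (@measurable_cst _ _ _ _ setT x) (@measurable_id _ _ setT)).
  - by move=> y _; rewrite lee_fin sqn_ge0.
  - by rewrite lee_fin sqn_ge0.
rewrite ge0_integralZr//.
- exact: measurable_esqn.
- by move=> x _; rewrite lee_fin sqn_ge0.
- exact: L2sq_ge0.
Qed.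

End ShortTimeFourier.

Lemma concentrated_measure_ge d (T : measurableType d) (R : realType)
    (mu : {measure set T -> \bar R}) (V : T -> R[i]) (Omega : set T) (eps : R) (A : \bar R) :
  measurable Omega -> cmeasurable_fun V -> 0 <= eps ->
  (forall z, ((sqn (V z))%:E <= A)%E) -> L2sq mu V = A -> (0 < A < +oo)%E ->
  (cLnorm mu 2 (fun z => (\1_(~` Omega) z)%:C * V z)%R <= eps%:E * cLnorm mu 2 V)%E ->
  ((1 - eps ^+ 2)%:E <= mu Omega)%E.
Proof.
move=> mO mV eps0 VA LV /andP[A0 Aoo] hc.
have eV := measurable_esqn mV.
have V0 z : (0 <= (sqn (V z))%:E)%E by rewrite lee_fin sqn_ge0.
have mC : measurable (~` Omega) by exact: measurableC.
have mI : cmeasurable_fun (fun z => (\1_(~` Omega) z)%:C * V z : R[i]).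
  apply: cmeasurableM => //; split => //=; exact: measurable_indic.
have outE : L2sq mu (fun z => (\1_(~` Omega) z)%:C * V z) =
    (\int[mu]_(z in ~` Omega) (sqn (V z))%:E)%E.
  rewrite [RHS]integral_mkcond; apply: eq_integral => z _.
  rewrite sqnM patchE indicE; case: ifP => _; rewrite /sqn /=; congr EFin; ring.
have out_le : (\int[mu]_(z in ~` Omega) (sqn (V z))%:E <= (eps ^+ 2)%:E * A)%E.
  rewrite -outE -(sqr_cLnorm2 mu mI) -LV -(sqr_cLnorm2 mu mV).
  apply: le_trans (lee_pmul _ _ hc hc) _; try exact: Lnorm_ge0.
  by rewrite muleACA -EFinM -expr2.
have in_le : (\int[mu]_(z in Omega) (sqn (V z))%:E <= A * mu Omega)%E.
  rewrite -integral_cst//; apply: ge0_le_integral => //.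
  exact: measurable_funTS.
have split_ : A = (\int[mu]_(z in Omega) (sqn (V z))%:E + \int[mu]_(z in ~` Omega) (sqn (V z))%:E)%E.
  rewrite -{1}LV /L2sq -{1}(setUv Omega) ge0_integral_setU//.
  - by rewrite setUv.
  - by apply/disj_setPS; rewrite setICr.
(* With both the measure and [A] finite, the inequality becomes one between reals and A > 0 can be
   cancelled. *)
have [->|moo] := eqVneq (mu Omega) +oo%E; first exact: leey.
have mfin : mu Omega \is a fin_num by rewrite ge0_fin_numE// ltey.
have Afin : A \is a fin_num by rewrite ge0_fin_numE// ltW.
have : (A <= A * mu Omega + (eps ^+ 2)%:E * A)%E by rewrite {1}split_ leeD.
move: A0; rewrite -(fineK mfin) -(fineK Afin) -!EFinM -EFinD !lee_fin lte_fin => a0 H.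
by rewrite -(ler_pM2l a0); lra.
Qed.

(** * Passage from Borel measure to its completion *)

Section CompletedMeasure.
Context d (T : measurableType d) (R : realType) (mu : {measure set T -> \bar R}).
Local Notation cT := (caratheodory_type (mu^*)%mu).
Local Notation cmu := (@completed_measure_extension _ _ _ mu).

(** The identity on points, seen as a map from the completed sigma-algebra to the original one. The
    completed measure pushes forward along it to [mu], so norms of measurable functions on [T] are
    unchanged. *)
Let to_T : cT -> T := id.

Lemma measurable_from_completion : measurable_fun [set: cT] to_T.
Proof.
move=> _ A mA; rewrite setTI.
by apply: sub_caratheodory; exact: sub_sigma_algebra.
Qed.

Lemma L2sq_completion (f : T -> R[i]) : cmeasurable_fun f ->
  L2sq (cmu : {measure set cT -> \bar R}) (f \o to_T) = L2sq mu f.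
Proof.
move=> mf; apply: esym; apply: (L2sq_image measurable_from_completion _ mf).
by move=> A mA; exact: esym (measurable_mu_extE mu mA).
Qed.

Lemma cmeasurable_completion (f : T -> R[i]) : cmeasurable_fun f ->
  cmeasurable_fun (f \o to_T).
Proof. by move=> mf; exact: (cmeasurable_comp mf measurable_from_completion). Qed.

End CompletedMeasure.

(** Existence of an L^2 extension ensures that [xget] returns a genuine transform and not its
    default 0. *)
Lemma fourier2P (R : realType) n (h : heis R n -> R[i]) :
  in_Lp (leb_heis R n) 2 h -> is_fourier2 h (fourier2 h).
Proof.
move=> hL; have [H hH] := plancherel_extension_exists (plancherel_heis R n) hL.
exact: (@xgetPex _ (fun=> 0) [set H | is_fourier2 h H] (ex_intro _ H hH)).
Qed.

(* fourier2 h is only known through its L^2 approximants, so positivity comes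
   from Plancherel for the approximants. *)
Lemma L2sq_fourier2_gt0 (R : realType) n (h : heis R n -> R[i]) :
  in_Lp (leb_heis R n) 2 h -> ~ (h = cst 0 %[ae leb_heis R n]) ->
  (0 < L2sq (leb_heis R n) (fourier2 h))%E.
Proof.
move=> hL h0; have [HL [u [uL uh uH]]] := fourier2P hL.
rewrite lt_neqAle L2sq_ge0 andbT; apply/eqP => /esym H0; apply: h0.
exact: (plancherel_extension_neq0 (plancherel_heis R n) hL HL uL uh uH H0).
Qed.

Theorem corollary4p4 (R : realType) (n : nat) (hn : (1 <= n)%N)
  (f g : heis R n -> R[i])
  (hf : in_Lp (leb_heis R n) 2 f) (hg : in_Lp (leb_heis R n) 2 g)
  (hf0 : ~ (f = cst 0 %[ae leb_heis R n]))
  (hg0 : ~ (g = cst 0 %[ae leb_heis R n]))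
  (Omega : set (heis2 R n)) (hOmega : measurable Omega)
  (eps : R) (heps0 : 0 < eps) (heps1 : eps < 1)
  (hconc : concentrated eps Omega (stft g f))
  (p : R) (hp : 2 < p) :
  (((1 - eps ^+ 2) `^ (p / (p - 2)))%:E <= leb_heis2 R n Omega)%E.
Proof.
have [mF Foo] := (in_L2P _ _).1 (fourier2P hf).1.
have [mG Goo] := (in_L2P _ _).1 (fourier2P hg).1.
have Pl := plancherel_heis R n.
have mmul := @measurable_heis_mul R n.
have Lr (h : heis R n -> R[i]) y : cmeasurable_fun h ->
    L2sq (leb_heis R n) (fun x => h (heis_mul x y)) = L2sq (leb_heis R n) h.
  move=> mh; apply: (heis_integral_mulr y (measurable_esqn mh)) => x.
  by rewrite lee_fin sqn_ge0.
have Ll (h : heis R n -> R[i]) x : cmeasurable_fun h ->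
    L2sq (leb_heis R n) (fun y => h (heis_mul x y)) = L2sq (leb_heis R n) h.
  move=> mh; apply: (heis_integral_mull x (measurable_esqn mh)) => y.
  by rewrite lee_fin sqn_ge0.
(* These three facts concern [short_time_ft], which coincides with [stft g f] by unfolding. *)
have mV := cmeasurable_short_time_ft Pl mmul mF mG.
have VL := L2sq_short_time_ft Pl mmul Lr Ll mF mG Foo Goo.
have Vle := short_time_ft_le Pl mmul Lr mF mG Foo Goo.
have A0 : (0 < L2sq (leb_heis R n) (fourier2 f) * L2sq (leb_heis R n) (fourier2 g) < +oo)%E.
  have pos (a b : \bar R) : (0 < a)%E -> (a < +oo)%E -> (0 < b)%E -> (b < +oo)%E ->
      (0 < a * b < +oo)%E.
    move=> a0 aoo b0 boo; rewrite mule_gt0//=.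
    by apply: lte_mul_pinfty => //; rewrite ?ltW// ge0_fin_numE// ltW.
  exact: (pos _ _ (L2sq_fourier2_gt0 hf hf0) Foo (L2sq_fourier2_gt0 hg hg0) Goo).
have conc := concentrated_measure_ge hOmega (cmeasurable_completion _ mV)
  (ltW heps0) Vle (etrans (L2sq_completion (leb_heis2_borel R n) mV) VL) A0 hconc.
apply: le_trans conc; rewrite lee_fin.
clear -heps0 heps1 hp.
have e1 : 0 < 1 - eps ^+ 2 <= 1.
  by apply/andP; split; nra.
(* The base lies in []0, 1]], where powers decrease with the exponent, and p / (p - 2) >= 1 because
   p > 2. *)
rewrite -[leRHS]powRr1; last by have /andP[/ltW] := e1.
apply: (ger_powR e1).
rewrite ler_pdivlMr; lra.
Qed.
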